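(* Let $[X,\mathcal B,m,\nu]$ be a reversible random walk space, $p>1$, and for each $x$ let $A_x,B_x\subset\mathrm{supp}(m_x)$ be non-null measurable sets with $A_x\cup B_x=\mathrm{supp}(m_x)$ (as in the context). Assume either (a) $\nu(X)<\infty$, or (b) $\nu(X)=+\infty$ and $p\ge2$. Then $$\partial_{L^2(X,\nu)}\big(\mathcal F_{A,1,m}+\mathcal F_{B,p,m}\big)=\partial_{L^2(X,\nu)}\mathcal F_{A,1,m}+\partial_{L^2(X,\nu)}\mathcal F_{B,p,m}=-\Delta_{1,A}^m-\Delta_{p,B}^m.$$ Furthermore, this operator is completely accretive and has dense domain in $L^2(X,\nu)$.
   Context: A random walk space $[X,\mathcal B,m,\nu]$: measurable space with countably generated $\sigma$-algebra, probability measures $m_x$ with $x\mapsto m_x(B)$ measurable, $\sigma$-finite invariant $\nu$ ($\nu(A)=\int m_x(A)\,d\nu(x)$); reversible: $dm_x(y)d\nu(x)=dm_y(x)d\nu(y)$. $\nu\otimes m_x$ is the measure $dm_x(y)d\nu(x)$ on $X\times X$; $\nabla u(x,y)=u(y)-u(x)$. The sets $\{(x,y):y\in A_x\}$, $\{(x,y):y\in B_x\}$ are measurable; $K_A(x,y)=\frac12(\chi_{A_x}(y)+\chi_{A_y}(x))$, $K_B(x,y)=\frac12(\chi_{B_x}(y)+\chi_{B_y}(x))$. On $L^2(X,\nu)$: $\mathcal F_{A,1,m}(u)=\frac12\int|\nabla u|K_A\,d(\nu\otimes m_x)$, $\mathcal F_{B,p,m}(u)=\frac1{2p}\int|\nabla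 u|^pK_B\,d(\nu\otimes m_x)$, each $+\infty$ if infinite. $\partial$ is the convex subdifferential; sum of operators is $\{(u,v_1+v_2):(u,v_i)\in A_i\}$. $(u,v)\in\Delta_{1,A}^m$ iff $(u,-v)\in\partial_{L^2(X,\nu)}\mathcal F_{A,1,m}(u)$. $(u,v)\in\Delta_{p,B}^m$ iff $u,v\in L^2(X,\nu)$, $\int K_B|\nabla u|^p\,d(\nu\otimes m_x)<\infty$ and $v(x)=\int_XK_B(x,y)|\nabla u(x,y)|^{p-2}\nabla u(x,y)\,dm_x(y)$. Complete accretivity of $A\subset L^2\times L^2$: for all $\lambda>0$, $(u_1,v_1),(u_2,v_2)\in A$, $\int j(u_1-u_2)\,d\nu\le\int j(u_1-u_2+\lambda(v_1-v_2))\,d\nu$ for all convex lower semicontinuous $j:\mathbb R\to[0,\infty]$ with $j(0)=0$. *)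

(* Defs.v *)
From HB Require Import structures.
From mathcomp Require Import all_boot all_order all_algebra.
From mathcomp Require Import all_classical all_reals all_analysis measurable_realfun.
Set Implicit Arguments. Unset Strict Implicit. Unset Printing Implicit Defensive.
Import Order.TTheory GRing.Theory Num.Theory.
Import numFieldNormedType.Exports.
Local Open Scope classical_set_scope.
Local Open Scope ring_scope.

Section RWS.
Context {d : measure_display} {X : measurableType d} {R : realType}.

Definition countably_generated :=
  exists G : (set X)^nat, (@measurable d X) = <<s range G>>.

Definition kernel_measurable (m : X -> probability X R) :=
  forall B, measurable B -> measurable_fun [set: X] ((fun x => m x B) : X -> \bar R).

Definition nuxm (nu : {measure set X -> \bar R}) (m : X -> probability X R)
  (f : X * X -> \bar R) : \bar R :=
  (\int[nu]_x \int[m x]_y f (x, y))%E.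

Definition nu_invariant (nu : {measure set X -> \bar R}) (m : X -> probability X R) :=
  forall A, measurable A -> nu A = (\int[nu]_x m x A)%E.

Definition nu_reversible (nu : {measure set X -> \bar R}) (m : X -> probability X R) :=
  forall C : set (X * X), measurable C ->
    nuxm nu m (fun xy => (\1_C xy)%:E) = nuxm nu m (fun xy => (\1_C (xy.2, xy.1))%:E).

Definition grad (u : X -> R) (xy : X * X) : R := u xy.2 - u xy.1.

Definition Kset (A : X -> set X) (xy : X * X) : R :=
  2^-1 * (\1_(A xy.1) xy.2 + \1_(A xy.2) xy.1).

Definition FA1 nu m (A : X -> set X) (u : X -> R) : \bar R :=
  ((2^-1)%:E * nuxm nu m (fun xy => (`|grad u xy| * Kset A xy)%:E))%E.

Definition FBp nu m (B : X -> set X) (p : R) (u : X -> R) : \bar R :=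
  (((2 * p)^-1)%:E * nuxm nu m (fun xy => (powR `|grad u xy| p * Kset B xy)%:E))%E.

(* u belongs to L^2(X, nu) (a representative of the class) *)
Definition L2 (nu : {measure set X -> \bar R}) (u : X -> R) :=
  measurable_fun setT u /\ (\int[nu]_x (`|u x| ^+ 2)%:E < +oo)%E.

(* operators on L^2 as relations: op u v means (u,v) in the operator *)
Definition op := (X -> R) -> (X -> R) -> Prop.

Definition subdiff nu (F : (X -> R) -> \bar R) : op := fun u v =>
  L2 nu u /\ L2 nu v /\ (F u < +oo)%E /\
  forall w, L2 nu w ->
    (F u + \int[nu]_x (v x * (w x - u x))%:E <= F w)%E.

Definition opadd (A1 A2 : op) : op := fun u v =>
  exists v1 v2, A1 u v1 /\ A2 u v2 /\ v = v1 \+ v2.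

Definition opneg (A : op) : op := fun u v => A u (\- v).

Definition Lap1 nu m (A : X -> set X) : op := fun u v =>
  subdiff nu (FA1 nu m A) u (\- v).

Definition Lapp nu m (B : X -> set X) (p : R) : op := fun u v =>
  L2 nu u /\ L2 nu v /\
  (nuxm nu m (fun xy => (Kset B xy * powR `|grad u xy| p)%:E) < +oo)%E /\
  {ae nu, forall x, (v x)%:E =
     (\int[m x]_y (Kset B (x, y) * powR `|grad u (x, y)| (p - 2) * grad u (x, y))%:E)%E}.

Definition admissible_j (j : R -> \bar R) :=
  (forall t, (0 <= j t)%E) /\ j 0 = 0%E /\
  (forall x y t : R, (0 < t < 1)%R ->
     (j (t * x + (1 - t) * y)%R <= t%:E * j x + (1 - t)%R%:E * j y)%E) /\
  (forall a : R, closed [set t | (j t <= a%:E)%E]).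

Definition completely_accretive nu (A : op) :=
  forall lam : R, 0 < lam -> forall u1 v1 u2 v2, A u1 v1 -> A u2 v2 ->
  forall j, admissible_j j ->
    (\int[nu]_x j (u1 x - u2 x)%R <= \int[nu]_x j (u1 x - u2 x + lam * (v1 x - v2 x))%R)%E.

Definition dense_domain nu (A : op) :=
  forall f, L2 nu f -> forall e : R, 0 < e ->
    exists u v, A u v /\ (\int[nu]_x (`|u x - f x| ^+ 2)%:E < e%:E)%E.

End RWS.

(* Main.v *)
Require Import Defs.
From HB Require Import structures.
From mathcomp Require Import all_boot all_order all_algebra.
From mathcomp Require Import all_classical all_reals all_analysis measurable_realfun.
From mathcomp Require Import ring lra.
Set Implicit Arguments. Unset Strict Implicit. Unset Printing Implicit Defensive.
Import Order.TTheory GRing.Theory Num.Theory.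
Import numFieldNormedType.Exports.
Local Open Scope classical_set_scope.
Local Open Scope ring_scope.

(** Write [M] for the measure dm_x(y) dnu(x) on [X * X] and [E_p u] for
    [2^-1 \int_M |grad u|^p / p K].  Both functionals have this form, [F_A] with
    [p = 1].  Reversibility makes [M] symmetric, so that Green's formula
    [2^-1 \int_M g (grad h) = - \int (\int g dm_x) h dnu] holds for antisymmetric
    [g]; let [D u = \int |grad u|^(p-2) (grad u) K dm_x].

    Let [v] be a subgradient of [G + E_p] at [u], where [G] is convex, decreases
    under truncation and is 1-Lipschitz for the norm of L^1.  As [E_p] has
    directional derivatives, [\int v h <= G (u + h) - G u - \int (D u) h] for
    bounded [h], and [h = +- \1_S] gives [|v + D u| <= 1] almost everywhere.  The
    assumption that [nu] is finite or [p >= 2] puts [D u] in L^2 + L^1, and then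
    this bound puts [D u] in L^2.  Truncating the competitors shows that [v + D u]
    is a subgradient of [G].  Taking [G = F_A] splits the subdifferential of the
    sum; taking [G = 0] identifies that of [E_p].

    Complete accretivity: if [T] is nondecreasing and 1-Lipschitz, replacing
    [(u1, u2)] by [(u1 - T (u1 - u2), u2 + T (u1 - u2))] decreases the sum of the
    energies, so [\int (v1 - v2) T (u1 - u2) >= 0].  Apply this to the derivatives
    of the Moreau envelopes of [j], which increase to [j].

    Density: if [u] is bounded with support of finite measure, then
    [|grad u|^(p-2) (grad u) K] is in L^2(M) for every [p >= 1], so both
    subdifferentials are nonempty at [u]. *)

(** * Real functions *)

Section real_functions.
Context {R : realType}.
Implicit Types (phi psi T : R -> R) (s t c : R).

Definition convexR phi := forall s t th, 0 <= th <= 1 ->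
  phi ((1 - th) * s + th * t) <= (1 - th) * phi s + th * phi t.

Definition subgradient phi psi := forall s t, phi t + psi t * (s - t) <= phi s.

Lemma subgradient_convex phi psi : subgradient phi psi -> convexR phi.
Proof.
move=> sub s t th /andP[th0 th1]; set r := _ + _.
have th1' : 0 <= 1 - th by rewrite subr_ge0.
have := ler_wpM2l th1' (sub s r); have := ler_wpM2l th0 (sub t r).
have : (1 - th) * (psi r * (s - r)) + th * (psi r * (t - r)) = 0.
  by rewrite /r; ring.
by rewrite !mulrDr; lra.
Qed.

Definition firmly_nonexpansive T :=
  forall s t, (T s - T t) ^+ 2 <= (T s - T t) * (s - t).

Section firmly_nonexpansive.
Variable T : R -> R.
Hypothesis T_firm : firmly_nonexpansive T.

Lemma firmly_nonexpansive_slope s t :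
  exists2 th, 0 <= th <= 1 & T s - T t = th * (s - t).
Proof.
have := T_firm s t; move: (T s - T t) (s - t) => a b ab.
have [b0|b0] := eqVneq b 0.
  exists 0; first by rewrite lexx ler01.
  apply/eqP; rewrite mul0r -sqrf_eq0 eq_le sqr_ge0 andbT.
  by move: ab; rewrite b0 mulr0.
have b2 : 0 < b ^+ 2 by rewrite exprn_even_gt0.
have a2 := sqr_ge0 a.
exists (a * b / b ^+ 2); last by field.
apply/andP; split; first exact: divr_ge0 (le_trans a2 ab) (ltW b2).
by rewrite ler_pdivrMr// mul1r; nra.
Qed.

Lemma firmly_nonexpansive_dist s t : `|T s - T t| <= `|s - t|.
Proof.
have [th /andP[th0 th1] ->] := firmly_nonexpansive_slope s t.
by rewrite normrM ger0_norm// ler_piMl.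
Qed.

Lemma firmly_nonexpansive_norm s : T 0 = 0 -> `|T s| <= `|s|.
Proof. by move=> T0; have := firmly_nonexpansive_dist s 0; rewrite T0 !subr0. Qed.

Lemma firmly_nonexpansive_measurable : measurable_fun setT T.
Proof.
apply: continuous_measurable_fun => s; apply/cvgrPdist_lt => e e0.
have /cvgrPdist_lt/(_ _ e0) := @cvg_id R (nbhs s).
by apply: filterS => t; exact: le_lt_trans (firmly_nonexpansive_dist _ _).
Qed.

End firmly_nonexpansive.

Definition clamp c t : R := Num.max (- c) (Num.min c t).

Lemma clampP c t : 0 <= c ->
  [\/ t <= - c /\ clamp c t = - c, c <= t /\ clamp c t = c |
     - c <= t <= c /\ clamp c t = t].
Proof.
move=> c0; rewrite /clamp; case: (leP c t) => ct.
  by apply: Or32; rewrite max_r//; lra.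
have [ct'|ct'] := leP (- c) t; last by apply: Or31; split=> //; lra.
by apply: Or33; split=> //; exact: ltW.
Qed.

Lemma norm_clamp_le c t : 0 <= c -> `|clamp c t| <= c.
Proof. by move=> c0; rewrite ler_norml; case: (clampP t c0) => -[? ->]; lra. Qed.

Lemma clamp_id c t : `|t| <= c -> clamp c t = t.
Proof. by rewrite ler_norml => /andP[? ?]; rewrite /clamp min_r// max_r. Qed.

Lemma clamp0 c : 0 <= c -> clamp c 0 = 0.
Proof. by move=> c0; rewrite clamp_id// normr0. Qed.

Lemma clamp_firmly_nonexpansive c : 0 <= c -> firmly_nonexpansive (clamp c).
Proof.
move=> c0 s t.
by case: (clampP s c0) => -[? ->]; case: (clampP t c0) => -[? ->]; nra.
Qed.

Lemma cvg_clamp t : clamp n%:R t @[n --> \oo] --> t.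
Proof.
apply: cvg_near_cst; near=> n; apply: clamp_id => //.
by near: n; exact: nbhs_infty_ger.
Unshelve. all: by end_near. Qed.

End real_functions.

(** * The potential |t|^p / p and its derivative *)

Section power_potential.
Context {R : realType}.
Variable p : R.
Implicit Types a b c s t : R.

Definition ppow t : R := `|t| `^ p / p.

(* For [p = 1] this is the sign function: the junk value [0 `^ (-1)] is multiplied by [0]. *)
Definition dppow t : R := `|t| `^ (p - 2) * t.

Lemma dppowN t : dppow (- t) = - dppow t.
Proof. by rewrite /dppow normrN mulrN. Qed.

Lemma measurable_norm_powR q : measurable_fun setT (fun t : R => `|t| `^ q).
Proof.
by apply: (measurableT_comp (f := @powR R ^~ q)) => //; exact: measurable_powR.
Qed.

Lemma measurable_ppow : measurable_fun setT ppow.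
Proof. by apply: measurable_funM => //; exact: measurable_norm_powR. Qed.

Lemma measurable_dppow : measurable_fun setT dppow.
Proof. by apply: measurable_funM => //; exact: measurable_norm_powR. Qed.

Lemma norm_dppow t : t != 0 -> `|dppow t| = `|t| `^ (p - 1).
Proof.
move=> t0; rewrite /dppow normrM (ger0_norm (powR_ge0 _ _)).
rewrite -[X in _ * X]powRr1// -powRD; last by rewrite normr_eq0 t0 implybT.
by congr (_ `^ _); ring.
Qed.

Hypothesis p1 : 1 <= p.

Let p0 : 0 < p. Proof. exact: lt_le_trans p1. Qed.

Lemma ppow_ge0 t : 0 <= ppow t.
Proof. by rewrite divr_ge0 ?powR_ge0// ltW. Qed.

Lemma ppowM t : p * ppow t = `|t| `^ p.
Proof. by rewrite mulrC divfK// gt_eqF. Qed.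

Lemma ppow0 : ppow 0 = 0.
Proof. by rewrite /ppow normr0 powR0 ?mul0r// gt_eqF. Qed.

Lemma ppow_le_norm a b : `|a| <= `|b| -> ppow a <= ppow b.
Proof.
move=> ab; rewrite ler_wpM2r ?invr_ge0 ?(ltW p0)//.
by apply: ge0_ler_powR => //; rewrite ?nnegrE// ltW.
Qed.

Lemma ppowD_le a b : ppow (a + b) <= 2 `^ p * (ppow a + ppow b).
Proof.
wlog ba : a b / `|b| <= `|a|.
  by move=> h; have [/h//|/ltW/h] := leP `|b| `|a|; rewrite addrC [X in _ * X]addrC.
have ab2 : `|a + b| <= `|2 * a|.
  by rewrite normrM ger0_norm// (le_trans (ler_normD a b))//; lra.
apply: le_trans (ppow_le_norm ab2) _.
rewrite /ppow normrM ger0_norm// powRM// -mulrA ler_wpM2l ?powR_ge0//.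
by rewrite lerDl ppow_ge0.
Qed.

Lemma dppow_mulr t : dppow t * t = p * ppow t.
Proof.
rewrite ppowM; have [->|t0] := eqVneq t 0.
  by rewrite mulr0 normr0 powR0// gt_eqF.
rewrite /dppow -mulrA -expr2 -real_normK ?num_real// -powR_mulrn//.
rewrite -powRD; last by rewrite normr_eq0 t0 implybT.
by rewrite subrK.
Qed.

Lemma dppow_young a b : `|dppow a * b| <= (p - 1) * ppow a + ppow b.
Proof.
have [->|a0] := eqVneq a 0.
  rewrite /dppow mulr0 mul0r normr0 addr_ge0 ?ppow_ge0//.
  by rewrite mulr_ge0 ?subr_ge0 ?ppow_ge0.
rewrite normrM norm_dppow// /ppow; have [->|p_neq1] := eqVneq p 1.
  by rewrite subrr powRr0 mul1r mul0r add0r powRr1// divr1.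
have pm1 : 0 < p - 1 by rewrite subr_gt0 lt_neqAle eq_sym p_neq1.
have pq : p^-1 + (p / (p - 1))^-1 = 1.
  by rewrite invf_div; field; rewrite gt_eqF.
have := conjugate_powR (normr_ge0 b) (powR_ge0 `|a| (p - 1)) p0 (divr_gt0 p0 pm1) pq.
rewrite -powRrM mulrCA divff ?gt_eqF// mulr1 mulrC => /le_trans; apply.
by rewrite addrC lerD2r invf_div mulrCA.
Qed.

Lemma ppow_subgradient : subgradient ppow dppow.
Proof.
move=> s t; have := le_trans (ler_norm _) (dppow_young t s).
by rewrite mulrBr dppow_mulr; lra.
Qed.

Lemma norm_dppow_le1 t : `|t| <= 1 -> `|dppow t| <= 1.
Proof.
move=> t1; have [->|t0] := eqVneq t 0; first by rewrite /dppow mulr0 normr0.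
rewrite norm_dppow// (le_trans (ge0_ler_powR _ _ _ t1)) ?powR1 ?nnegrE//.
by rewrite subr_ge0.
Qed.

Lemma norm_dppow_le t : 2 <= p -> `|t| <= 1 -> `|dppow t| <= `|t|.
Proof.
move=> p2 t1; have [->|t0] := eqVneq t 0; first by rewrite /dppow mulr0.
by rewrite norm_dppow// ge1r_powR ?normr_gt0 ?t0//; lra.
Qed.

Lemma norm_dppow_le_ppow t : 1 < `|t| -> `|dppow t| <= p * ppow t.
Proof.
move=> t1; have t0 : t != 0 by rewrite -normr_gt0 (lt_trans _ t1).
by rewrite norm_dppow// ppowM ler_powR ?gerBl// ltW.
Qed.

Lemma norm_dppow_bounded c t : `|t| <= c -> `|dppow t| <= c `^ (p - 1).
Proof.
move=> tc; have [->|t0] := eqVneq t 0.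
  by rewrite /dppow mulr0 normr0 powR_ge0.
rewrite norm_dppow//; apply: ge0_ler_powR; rewrite ?nnegrE ?subr_ge0//.
exact: le_trans tc.
Qed.

Lemma ppow_bounded c t : 2 <= p -> `|t| <= c ->
  ppow t <= c `^ (p - 2) / p * t ^+ 2.
Proof.
move=> p2 tc; rewrite mulrAC ler_wpM2r ?invr_ge0 ?(ltW p0)//.
rewrite -ppowM -dppow_mulr /dppow -mulrA -expr2 ler_wpM2r ?sqr_ge0//.
by apply: ge0_ler_powR; rewrite ?nnegrE ?subr_ge0// (le_trans _ tc).
Qed.

End power_potential.

Lemma continuous_dppow {R : realType} (p : R) : 1 < p -> continuous (dppow p).
Proof.
move=> p1 t; have pm1 : 0 < p - 1 by rewrite subr_gt0.
have [->|t0] := eqVneq t 0; last first.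
  apply: (@cvgM _ _ _ _ (fun s => `|s| `^ (p - 2)) id); last exact: cvg_id.
  apply: (@continuous_comp _ _ _ (fun s : R => `|s|) (@powR R ^~ (p - 2))).
    exact: norm_continuous.
  apply/differentiable_continuous/derivable1_diffP/derivable_powR.
  by rewrite in_itv/= andbT normr_gt0.
rewrite /continuous_at (_ : dppow p 0 = 0); last by rewrite /dppow mulr0.
apply/cvgrPdist_lt => e e0; near=> s; rewrite sub0r normrN.
have [->|s0] := eqVneq s 0; first by rewrite /dppow mulr0 normr0.
rewrite norm_dppow// (_ : e = (e `^ (p - 1)^-1) `^ (p - 1)); last first.
  by rewrite -powRrM mulVf ?gt_eqF// powRr1// ltW.
apply: gt0_ltr_powR => //; rewrite ?nnegrE ?powR_ge0//.
by near: s; apply: (@cvgr0_norm_lt _ _ _ _ _ id) => //; exact: powR_gt0.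
Unshelve. all: by end_near. Qed.

(** * Integrals of real functions *)

Section real_integral.
Context {d : measure_display} {T : measurableType d} {R : realType}.
Variable mu : {measure set T -> \bar R}.
Implicit Types (f g : T -> R) (c k : R).

Definition rintegrable f := mu.-integrable setT (EFin \o f).

Lemma rintegrable_measurable f : rintegrable f -> measurable_fun setT f.
Proof. by move=> /measurable_int /measurable_EFinP. Qed.

Lemma rintegrable_le f g : measurable_fun setT f -> rintegrable g ->
  (forall x, `|f x| <= g x) -> rintegrable f.
Proof.
move=> mf gi fg; apply: le_integrable gi => //; first exact/measurable_EFinP.
by move=> x _; rewrite /= lee_fin (le_trans (fg x))// ler_norm.
Qed.

Lemma ge0_rintegrable f : measurable_fun setT f -> (forall x, 0 <= f x) ->
  (\int[mu]_x (f x)%:E < +oo)%E -> rintegrable f.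
Proof.
move=> mf f0 fy; apply/integrableP; split; first exact/measurable_EFinP.
by under eq_integral do rewrite gee0_abs ?lee_fin//.
Qed.

Lemma rintegralE f : rintegrable f ->
  (\int[mu]_x (f x)%:E)%E = (\int[mu]_x f x)%:E.
Proof. by move=> fi; rewrite fineK//; exact: integrable_fin_num fi. Qed.

Lemma rintegrableD f g : rintegrable f -> rintegrable g ->
  rintegrable (fun x => f x + g x).
Proof. exact: integrableD. Qed.

Lemma rintegrableB f g : rintegrable f -> rintegrable g ->
  rintegrable (fun x => f x - g x).
Proof. exact: integrableB. Qed.

Lemma rintegrableZl k f : rintegrable f -> rintegrable (fun x => k * f x).
Proof. exact: integrableZl. Qed.

Lemma rintegrableN f : rintegrable f -> rintegrable (fun x => - f x).
Proof. by move=> fi; under eq_fun do rewrite -mulN1r; exact: rintegrableZl. Qed.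

Lemma rintegrable_norm f : rintegrable f -> rintegrable (fun x => `|f x|).
Proof. exact: integrable_norm. Qed.

Lemma rintegrable_cst c : (mu setT < +oo)%E -> rintegrable (cst c).
Proof.
move=> muy; apply/integrableP; split; first exact/measurable_EFinP.
by rewrite /= integral_cst//= lte_mul_pinfty.
Qed.

Lemma rintegrable_indic E : measurable E -> (mu E < +oo)%E -> rintegrable \1_E.
Proof.
by move=> mE Ey; apply: ge0_rintegrable => //; rewrite integral_indic// setIT.
Qed.

Lemma RintegralN f : rintegrable f -> \int[mu]_x (- f x) = - \int[mu]_x f x.
Proof.
by move=> fi; rewrite -mulN1r -RintegralZl//; under eq_Rintegral do rewrite -mulN1r.
Qed.

(* If [f] is not integrable and [k != 0], both sides are [fine] of an infinite
   value, that is [0]. *)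
Lemma RintegralZl_measurable k f : measurable_fun setT f ->
  \int[mu]_x (k * f x) = k * \int[mu]_x f x.
Proof.
move=> mf; have [->|k0] := eqVneq k 0.
  by under eq_Rintegral do rewrite mul0r; rewrite Rintegral_cst// !mul0r.
have [fi|fi] := boolP (mu.-integrable setT (EFin \o f)); first exact: RintegralZl.
have int0 g : measurable_fun setT g -> ~~ mu.-integrable setT (EFin \o g) ->
    \int[mu]_x g x = 0.
  move=> mg; have mEg : measurable_fun setT (EFin \o g) by exact/measurable_EFinP.
  rewrite /Rintegral.
  case E : (\int[mu]_x (g x)%:E)%E => [r| |]//= /negP[].
  by apply/integrableP; split=> //; apply/abse_integralP; rewrite //= E ltry.
rewrite [in RHS]int0// mulr0 int0//; first exact: measurable_funM.
apply: contra fi => /(integrableZl measurableT k^-1).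
by apply: eq_integrable => // x _; rewrite /= -EFinM mulKf.
Qed.

Lemma cvg_dominated_Rintegral (f_ : nat -> T -> R) f g :
  (forall n, measurable_fun setT (f_ n)) ->
  (forall x, f_ n x @[n --> \oo] --> f x) ->
  rintegrable g -> (forall n x, `|f_ n x| <= g x) ->
  \int[mu]_x f_ n x @[n --> \oo] --> \int[mu]_x f x.
Proof.
move=> mf_ f_f gi f_g.
have mf : measurable_fun setT f by exact: (measurable_fun_cvg mf_ (fun x _ => f_f x)).
have [||||i _ cv] := @dominated_convergence _ _ _ mu _ measurableT
  (fun n => EFin \o f_ n) (EFin \o f) (EFin \o g) _ _ _ gi _.
- by move=> n; exact/measurable_EFinP.
- exact/measurable_EFinP.
- apply: aeW => x _; apply/cvg_EFin; last exact: f_f.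
  by apply: nearW => n.
- by apply: aeW => x n _; rewrite /= lee_fin.
by move: cv; rewrite rintegralE// => /fine_cvg; exact.
Qed.

Lemma eq_ae_rintegrable f g : measurable_fun setT g ->
  {ae mu, forall x, f x = g x} -> rintegrable f -> rintegrable g.
Proof.
move=> mg fg fi; have mf := rintegrable_measurable fi.
apply/integrableP; split; first exact/measurable_EFinP.
have /integrableP[_] := fi; congr (_ < _)%E.
apply: ge0_ae_eq_integral => //.
- by apply: measurableT_comp => //; exact/measurable_EFinP.
- by apply: measurableT_comp => //; exact/measurable_EFinP.
- by apply: filterS fg => x /= -> _.
Qed.

Lemma eq_ae_Rintegral f g : measurable_fun setT f -> measurable_fun setT g ->
  {ae mu, forall x, f x = g x} -> \int[mu]_x f x = \int[mu]_x g x.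
Proof.
move=> mf mg fg; congr fine; apply: ae_eq_integral => //.
- exact/measurable_EFinP.
- exact/measurable_EFinP.
- by apply: filterS fg => x /= -> _.
Qed.

Lemma ae_le_rintegrable f g : measurable_fun setT f -> rintegrable g ->
  {ae mu, forall x, `|f x| <= g x} -> rintegrable f.
Proof.
move=> mf gi fg; have mg := rintegrable_measurable gi.
have mh : measurable_fun setT (fun x => Num.max (`|f x|) (g x)).
  by apply: measurable_maxr => //; exact: measurableT_comp.
apply: (rintegrable_le mf (g := fun x => Num.max `|f x| (g x))).
  by apply: eq_ae_rintegrable mh _ gi; apply: filterS fg => x fgx; rewrite max_r.
by move=> x; rewrite le_max lexx.
Qed.

Lemma Rintegral_le0_ae_eq0 f : rintegrable f -> (forall x, 0 <= f x) ->
  \int[mu]_x f x <= 0 -> {ae mu, forall x, f x = 0}.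
Proof.
move=> fi f0 fle; have mf : measurable_fun setT (EFin \o f) by exact: measurable_int fi.
have : (\int[mu]_x `|(EFin \o f) x| = 0)%E.
  under eq_integral do rewrite gee0_abs ?lee_fin//.
  by rewrite rintegralE//; congr EFin; apply/eqP; rewrite eq_le fle Rintegral_ge0.
move/(ae_eq_integral_abs mu measurableT mf); apply: filterS => x /(_ I).
by move=> [].
Qed.

Lemma ae_le_cst_indic f c : sigma_finite setT mu -> measurable_fun setT f ->
  (forall E, measurable E -> (mu E < +oo)%E ->
    rintegrable (fun x => f x * \1_E x) /\
    \int[mu]_x (f x * \1_E x) <= c * \int[mu]_x \1_E x) ->
  {ae mu, forall x, f x <= c}.
Proof.
move=> [S S_cover S_fin] mf test; pose E n := [set x | c < f x] `&` S n.
have E_null n : mu.-negligible (E n).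
  have [mS Sy] := S_fin n.
  have mE : measurable (E n).
    apply: measurableI => //; rewrite -[X in measurable X]setTI.
    rewrite (_ : [set x | _] = f @^-1` `]c, +oo[%classic); first exact: mf.
    by apply/seteqP; split=> x /=; rewrite in_itv/= andbT.
  have Ey : (mu (E n) < +oo)%E.
    by apply: le_lt_trans Sy; apply: le_measure; rewrite ?inE//; exact: subIsetr.
  have Ei := rintegrable_indic mE Ey; have [fEi fEle] := test _ mE Ey.
  have gap0 x : 0 <= f x * \1_(E n) x - c * \1_(E n) x.
    rewrite -mulrBl indicE; have [|_] := boolP (x \in _); last by rewrite mulr0.
    by rewrite inE mulr1 subr_ge0 => -[/ltW].
  have := Rintegral_le0_ae_eq0 (rintegrableB fEi (rintegrableZl c Ei)) gap0.
  rewrite RintegralB ?RintegralZl ?subr_le0//; last exact: (rintegrableZl c Ei).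
  move=> /(_ fEle); apply: negligibleS => x Ex /= /eqP; case: (Ex) => /= cf _.
  by rewrite -mulrBl indicE mem_set// mulr1 subr_eq0 (gt_eqF cf).
apply: (negligibleS _ (negligible_bigcup E_null)) => x /= /negP; rewrite -ltNge.
by move=> cf; have : setT x by []; rewrite S_cover => -[n _ Sx]; exists n.
Qed.

End real_integral.

(** * Square integrable functions and the sum space L^2 + L^1 *)

Section square_integrable.
Context {d : measure_display} {T : measurableType d} {R : realType}.
Variable mu : {measure set T -> \bar R}.
Implicit Types (f g h : T -> R) (c k : R).

Lemma L2P f : L2 mu f <->
  measurable_fun setT f /\ rintegrable mu (fun x => f x ^+ 2).
Proof.
split=> -[mf f2]; split=> //.
  apply: ge0_rintegrable => [|x|]; [exact: measurable_funX|exact: sqr_ge0|].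
  by under eq_integral do rewrite -real_normK ?num_real//.
under eq_integral do rewrite real_normK ?num_real//.
by rewrite rintegralE// ltry.
Qed.

Lemma L2_Lfun f : L2 mu f <-> f \in Lfun mu 2%:E.
Proof.
split=> [[mf f2]|f2].
  rewrite inE; apply/andP; split; rewrite inE// /finite_norm /= unlock.
  apply: poweR_lty; apply: le_lt_trans f2; rewrite le_eqVlt; apply/orP; left.
  by apply/eqP; apply: eq_integral => x _; rewrite /= powR_mulrn.
apply/L2P; split; last exact: Lfun2_integrable_sqr.
by move: f2; rewrite inE => /andP[]; rewrite inE.
Qed.

Lemma L2_measurable f : L2 mu f -> measurable_fun setT f. Proof. by case. Qed.

Lemma L2_le f g : measurable_fun setT f -> L2 mu g ->
  (forall x, `|f x| <= `|g x|) -> L2 mu f.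
Proof.
move=> mf /L2P[mg g2] fg; apply/L2P; split=> //.
apply: rintegrable_le g2 _ => [|x]; first exact: measurable_funX.
rewrite ger0_norm ?sqr_ge0// -real_normK ?num_real// -[leRHS]real_normK ?num_real//.
by rewrite lerXn2r ?nnegrE.
Qed.

Lemma L2D f g : L2 mu f -> L2 mu g -> L2 mu (fun x => f x + g x).
Proof.
move=> /L2_Lfun f2 /L2_Lfun g2; apply/L2_Lfun.
by apply: (rpredD f2 g2); rewrite lee1n.
Qed.

Lemma L2Z k f : L2 mu f -> L2 mu (fun x => k * f x).
Proof.
move=> /L2P[mf f2]; apply/L2P; split; first exact: measurable_funM.
by under eq_fun do rewrite exprMn; exact: rintegrableZl.
Qed.

Lemma L2N f : L2 mu f -> L2 mu (fun x => - f x).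
Proof. by move=> /(L2Z (-1)); under eq_fun do rewrite mulN1r. Qed.

Lemma L2B f g : L2 mu f -> L2 mu g -> L2 mu (fun x => f x - g x).
Proof. by move=> f2 /L2N; exact: L2D. Qed.

Lemma L2_mul f g : L2 mu f -> L2 mu g -> rintegrable mu (fun x => f x * g x).
Proof.
by move=> /L2_Lfun f2 /L2_Lfun g2; apply/Lfun1_integrable; exact: Lfun2_mul_Lfun1.
Qed.

Lemma eq_ae_L2 f g : measurable_fun setT g ->
  {ae mu, forall x, f x = g x} -> L2 mu f -> L2 mu g.
Proof.
move=> mg fg /L2P[mf f2]; apply/L2P; split=> //.
apply: eq_ae_rintegrable f2; first exact: measurable_funX.
by apply: filterS fg => x ->.
Qed.

Lemma L2_firmly_nonexpansive (S : R -> R) f :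
  firmly_nonexpansive S -> S 0 = 0 -> L2 mu f -> L2 mu (fun x => S (f x)).
Proof.
move=> S_firm S0 f2; apply: L2_le (f2) _.
  exact: measurableT_comp (firmly_nonexpansive_measurable S_firm) (L2_measurable f2).
by move=> x; exact: firmly_nonexpansive_norm.
Qed.

Lemma L2_clamp c f : 0 <= c -> L2 mu f -> L2 mu (fun x => clamp c (f x)).
Proof.
by move=> c0; apply: L2_firmly_nonexpansive;
  [exact: clamp_firmly_nonexpansive|exact: clamp0].
Qed.

Lemma L2_indic E : measurable E -> (mu E < +oo)%E -> L2 mu (\1_E).
Proof.
move=> mE Ey; apply/L2P; split; first exact: measurable_indic.
rewrite (_ : (fun x => _) = \1_E); first exact: rintegrable_indic.
by apply/funext => x; rewrite indicE; case: (_ \in _); rewrite ?expr1n ?expr0n.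
Qed.

Lemma L2_cst c : (mu setT < +oo)%E -> L2 mu (cst c).
Proof. by move=> muy; apply/L2P; split=> //; exact: (rintegrable_cst (c ^+ 2)). Qed.

Lemma L2_superlevel f (e : R) : L2 mu f -> 0 < e ->
  measurable [set x | e <= `|f x|] /\ (mu [set x | (e <= `|f x|)%R] < +oo)%E.
Proof.
move=> /L2P[mf f2] e0; have e20 : 0 < e ^+ 2 by rewrite exprn_gt0.
split.
  rewrite (_ : [set x | _] = setT `&` (fun x => `|f x|) @^-1` `[e, +oo[%classic).
    have mnf : measurable_fun setT (fun x => `|f x|) by exact: measurableT_comp.
    by apply: mnf => //; exact: measurable_itv.
  by rewrite setTI; apply/seteqP; split=> x /=; rewrite in_itv/= andbT.
rewrite (_ : [set x | _] = setT `&` [set x | ((e ^+ 2)%:E <= `|(f x ^+ 2)%:E|)%E]).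
  rewrite -(@lte_pmul2l _ (e ^+ 2)%:E) ?lte_fin// gt0_muley ?lte_fin//.
  apply: (@le_lt_trans _ _ (\int[mu]_x `|(f x ^+ 2)%:E|)%E); last by case/integrableP: f2.
  apply: (@le_integral_comp_abse _ _ _ mu _ measurableT
    (fun x => (f x ^+ 2)%:E) (e ^+ 2) id) => //.
  exact: measurable_int f2.
rewrite setTI; apply/seteqP; split=> x /=; rewrite lee_fin normrX.
  by move=> ex; rewrite lerXn2r ?nnegrE// ltW.
by rewrite ler_sqr ?nnegrE// ltW.
Qed.

Lemma L2_bounded_support_dense f (e : R) : L2 mu f -> 0 < e ->
  exists (E : set T) c (u : T -> R), [/\ measurable E /\ (mu E < +oo)%E, measurable_fun setT u,
    forall x, `|u x| <= c * \1_E x &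
    (\int[mu]_x (`|u x - f x| ^+ 2)%:E < e%:E)%E].
Proof.
move=> f2 e0; have /L2P[mf fi] := f2.
pose E n := [set x | n.+1%:R^-1 <= `|f x|]; pose c n : R := n%:R.
have E_fin n : measurable (E n) /\ (mu (E n) < +oo)%E by exact: L2_superlevel.
pose u n x := clamp (c n) (f x) * \1_(E n) x.
have mu_ n : measurable_fun setT (u n).
  apply: measurable_funM; last by apply: measurable_indic; case: (E_fin n).
  exact: L2_measurable (L2_clamp _ f2).
have u_bound n x : `|u n x| <= c n * \1_(E n) x.
  by rewrite normrM (ger0_norm (_ : 0 <= \1_(E n) x))// ler_wpM2r ?norm_clamp_le.
have cvg_u x : (u n x - f x) ^+ 2 @[n --> \oo] --> (0 : R).
  have [f0|f0] := eqVneq (f x) 0.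
    apply: cvg_near_cst; apply: nearW => n.
    by rewrite /u f0 clamp0// mul0r subrr expr0n.
  have nf0 : 0 < `|f x| by rewrite normr_gt0.
  apply: cvg_near_cst; near=> n.
  rewrite /u indicE mem_set ?mulr1 ?clamp_id ?subrr ?expr0n//=.
    by near: n; exact: nbhs_infty_ger.
  by near: n; apply: filterS (near_infty_natSinv_lt (PosNum nf0)) => n /ltW.
have u_dom n x : `|(u n x - f x) ^+ 2| <= f x ^+ 2.
  rewrite ger0_norm ?sqr_ge0// /u indicE; case: (x \in _); last first.
    by rewrite mulr0 sub0r sqrrN.
  have := clamp_firmly_nonexpansive (ler0n R n) (f x) 0.
  rewrite clamp0// !subr0 mulr1; nra.
have m_uf n : measurable_fun setT (fun x => (u n x - f x) ^+ 2).
  by apply: measurable_funX; exact: measurable_funB.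
have := cvg_dominated_Rintegral m_uf cvg_u fi u_dom.
rewrite (Rintegral_cst mu measurableT 0) mul0r => /cvgr_lt/(_ _ e0)[N _ /(_ N (leqnn N))].
move=> uN; exists (E N), (c N), (u N); split=> //.
under eq_integral do rewrite real_normK ?num_real//.
by rewrite rintegralE ?lte_fin//; exact: rintegrable_le (m_uf N) fi (u_dom N).
Unshelve. all: by end_near. Qed.

Definition L2_plus_L1 f :=
  exists g h, [/\ L2 mu g, rintegrable mu h & f = (fun x => g x + h x)].

Lemma L2_plus_L1_measurable f : L2_plus_L1 f -> measurable_fun setT f.
Proof.
move=> [g [h [[mg _] hi ->]]].
exact: measurable_funD (rintegrable_measurable hi).
Qed.

Lemma L2_plus_L1_mul f g c : L2_plus_L1 f -> L2 mu g ->
  (forall x, `|g x| <= c) -> rintegrable mu (fun x => f x * g x).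
Proof.
move=> [a [b [a2 bi ->]]] g2 gc; under eq_fun do rewrite mulrDl.
apply: rintegrableD; first exact: L2_mul.
apply: rintegrable_le (rintegrableZl c (rintegrable_norm bi)) _.
  by apply: measurable_funM; [exact: rintegrable_measurable bi|exact: L2_measurable g2].
by move=> x; rewrite normrM mulrC ler_wpM2r.
Qed.

Lemma L2_plus_L1_L2 f g : L2_plus_L1 f -> L2 mu g ->
  {ae mu, forall x, `|f x| <= `|g x| + 1} -> L2 mu f.
Proof.
move=> fab g2 fg; have mf := L2_plus_L1_measurable fab.
have [a [b [a2 bi fE]]] := fab; apply/L2P; split=> //.
have /L2P[_ g2'] := g2; have /L2P[_ a2'] := a2.
have dom := rintegrableZl 2 (rintegrableD (rintegrableD a2' g2') (rintegrable_norm bi)).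
apply: ae_le_rintegrable dom _; first exact: measurable_funX.
have sqr_bound (F A B G : R) : 0 <= F -> 0 <= A -> 0 <= B -> 0 <= G ->
    F <= A + B -> F <= G + 1 -> F ^+ 2 <= 2 * (A ^+ 2 + G ^+ 2 + B).
  move=> F0 A0 B0 G0 F_AB F_G; have [B1|B1] := leP B 1.
    have : F ^+ 2 <= (A + B) ^+ 2 by rewrite lerXn2r ?nnegrE ?addr_ge0.
    by have := sqr_ge0 (A - B); nra.
  have : F ^+ 2 <= (G + 1) ^+ 2 by rewrite lerXn2r ?nnegrE ?addr_ge0.
  by have := sqr_ge0 (G - 1); nra.
apply: filterS fg => x fgx; rewrite normrX.
rewrite -[in leRHS](real_normK (num_real (a x))) -[in leRHS](real_normK (num_real (g x))).
by apply: sqr_bound => //; rewrite fE ler_normD.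
Qed.

End square_integrable.

Lemma probability_sqr_Rintegral_le {d : measure_display} {T : measurableType d}
    {R : realType} (P : probability T R) (f : T -> R) : L2 P f ->
  (\int[P]_x f x) ^+ 2 <= \int[P]_x (f x ^+ 2).
Proof.
move=> f2; have fL : f \in Lfun P 2%:E by exact/L2_Lfun.
have fi : rintegrable P f.
  by apply/Lfun1_integrable; apply: Lfun_subset12 fL; exact: fin_num_measure.
have /L2P[_ f2'] := f2; have := variance_ge0 P f; rewrite varianceE// unlock.
rewrite (_ : (f ^+ 2)%R = (fun x => f x ^+ 2)); last first.
  by apply/funext => x; rewrite expr2.
by rewrite !rintegralE// -EFin_expe -EFinB lee_fin subr_ge0.
Qed.

(** * Moreau envelopes *)

Section moreau.
Context {R : realType}.
Variable j : R -> \bar R.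
Hypothesis hj : admissible_j j.
Implicit Types (a b c r s t x y z : R).

Lemma admissible_ge0 t : (0 <= j t)%E. Proof. by case: hj. Qed.

Lemma admissible0 : j 0 = 0%E. Proof. by case: hj => _ []. Qed.

Lemma admissible_convex x y a b t : 0 < t < 1 -> (j x <= a%:E)%E -> (j y <= b%:E)%E ->
  (j (t * x + (1 - t) * y) <= (t * a + (1 - t) * b)%:E)%E.
Proof.
case: hj => _ [_ [cvx _]] /[dup] t01 /andP[t0 t1] jx jy.
apply: le_trans (cvx x y t t01) _.
rewrite [leRHS](_ : _ = (t%:E * a%:E + (1 - t)%:E * b%:E)%E)//.
by apply: leeD; apply: lee_wpmul2l => //; rewrite lee_fin; lra.
Qed.

Lemma admissible_le_lim (y_ a_ : R^nat) y a : y_ n @[n --> \oo] --> y ->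
  a_ n @[n --> \oo] --> a -> (forall n, (j (y_ n) <= (a_ n)%:E)%E) -> (j y <= a%:E)%E.
Proof.
case: hj => _ [_ [_ lsc]] cvg_y cvg_a jy; apply/lee_addgt0Pr => e e0; rewrite -EFinD.
apply: (@closed_cvg _ _ _ _ y_ _ (lsc (a + e)) _ y cvg_y).
near=> n; apply: le_trans (jy n) _; rewrite lee_fin ltW//.
by near: n; apply: (cvgr_lt _ cvg_a); rewrite ltrDl.
Unshelve. all: by end_near. Qed.

Lemma measurable_admissible : measurable_fun setT j.
Proof.
apply: lower_semicontinuous_measurable; apply/lower_semicontinuousP => a.
case: hj => _ [_ [_ /(_ a)/closed_openC]].
congr open; apply/seteqP; split=> x /=; first by move/negP; rewrite -ltNge.
by rewrite ltNge => /negP.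
Qed.

(* That is, [j y + c / 2 * (x - y) ^+ 2 <= r], with only real numbers on the right. *)
Definition penalized c x y r := (j y <= (r - c / 2 * (x - y) ^+ 2)%:E)%E.

Definition moreau_env c x := inf [set r | exists y, penalized c x y r].

Section fixed_parameter.
Variable c : R.
Hypothesis c0 : 0 < c.

Let env := moreau_env c.

Let penalty_ge0 x y : 0 <= c / 2 * (x - y) ^+ 2.
Proof. by rewrite mulr_ge0 ?sqr_ge0// divr_ge0// ltW. Qed.

Lemma penalized_ge0 x y r : penalized c x y r -> 0 <= r.
Proof.
move=> /(le_trans (admissible_ge0 y)); rewrite lee_fin subr_ge0.
exact: le_trans (penalty_ge0 x y).
Qed.

Lemma penalized_id x r : (j x <= r%:E)%E -> penalized c x x r.
Proof. by rewrite /penalized subrr expr0n mulr0 subr0. Qed.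

Lemma penalized_bounded_below x : has_inf [set r | exists y, penalized c x y r].
Proof.
split; last by exists 0 => r [y /penalized_ge0].
by exists (c / 2 * x ^+ 2), 0; rewrite /penalized admissible0 subr0 subrr.
Qed.

Lemma moreau_env_le x y r : penalized c x y r -> env x <= r.
Proof.
by move=> h; apply: ge_inf; [case: (penalized_bounded_below x)|exists y].
Qed.

Lemma moreau_env_leD x y r : (j y <= r%:E)%E -> env x <= r + c / 2 * (x - y) ^+ 2.
Proof. by move=> h; apply: (@moreau_env_le x y); rewrite /penalized addrK. Qed.

Lemma penalized_midpoint x y z r s : penalized c x y r -> penalized c x z s ->
  penalized c x ((y + z) / 2) ((r + s) / 2 - c / 8 * (y - z) ^+ 2).
Proof.
move=> y_r z_s; have half01 : 0 < (2^-1 : R) < 1 by lra.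
have := admissible_convex half01 y_r z_s.
rewrite /penalized (_ : 2^-1 * y + _ = (y + z) / 2); last by field.
by congr (_ <= _%:E)%E; field.
Qed.

(* Strong convexity of the penalised cost makes minimising sequences Cauchy. *)
Lemma penalized_minimizing_cauchy x (y_ : R^nat) :
  (forall n, penalized c x (y_ n) (env x + n.+1%:R^-1)) -> cvgn y_.
Proof.
move=> yP.
have close n k e : 0 < e -> n.+1%:R^-1 < c / 8 * e ^+ 2 -> (n <= k)%N ->
    `|y_ n - y_ k| < e.
  move=> e0 n_e nk; have := moreau_env_le (penalized_midpoint (yP n) (yP k)).
  have : (k.+1%:R^-1 : R) <= n.+1%:R^-1 by rewrite lef_pV2 ?posrE ?ler_nat.
  move: (env x) (n.+1%:R^-1) (k.+1%:R^-1) n_e => E a b a_e ba E_le.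
  have : c / 8 * (y_ n - y_ k) ^+ 2 < c / 8 * e ^+ 2 by lra.
  rewrite ltr_pM2l ?divr_gt0// -(real_normK (num_real (_ - _))).
  by rewrite ltr_sqr ?nnegrE// ltW.
apply/cauchy_cvgP/cauchy_ballP => e e0.
have e2 : 0 < c / 8 * e ^+ 2 by rewrite mulr_gt0 ?exprn_gt0// divr_gt0.
have [N _ HN] := near_infty_natSinv_lt (PosNum e2).
exists (y_ @` [set n | (N <= n)%N], y_ @` [set n | (N <= n)%N]) => /=.
  by split; exists N => // n /= Nn; exists n.
move=> [_ _] /= [[n /= Nn <-] [k /= Nk <-]]; rewrite /ball /= .
have [nk|/ltnW kn] := leqP n k; first exact: close e0 (HN n Nn) nk.
by rewrite distrC; exact: close e0 (HN k Nk) kn.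
Qed.

Lemma moreau_env_attained x : exists y, penalized c x y (env x).
Proof.
have minimizing (n : nat) : exists y, penalized c x y (env x + n.+1%:R^-1).
  have n0 : 0 < n.+1%:R^-1 :> R by rewrite invr_gt0.
  have [r [y y_r] r_lt] := inf_adherent n0 (penalized_bounded_below x).
  by exists y; apply: le_trans y_r _; rewrite lee_fin lerB// ltW.
have [y_ yP] := choice minimizing; have cvg_y := penalized_minimizing_cauchy yP.
exists (limn y_); apply: (admissible_le_lim cvg_y _ yP); apply: cvgB.
  by rewrite -[X in _ --> X]addr0; apply: cvgD; [exact: cvg_cst|exact: cvg_harmonic].
have cvg_xy : x - y_ n @[n --> \oo] --> x - limn y_ by apply: cvgB => //; exact: cvg_cst.
by apply: cvgM; [exact: cvg_cst|rewrite expr2; under eq_fun do rewrite expr2; exact: cvgM].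
Qed.

Definition prox x := sval (cid (moreau_env_attained x)).

Let prox_val x := env x - c / 2 * (x - prox x) ^+ 2.

Let prox_le x : (j (prox x) <= (prox_val x)%:E)%E.
Proof. exact: (svalP (cid (moreau_env_attained x))). Qed.

Let prox_val_ge0 x : 0 <= prox_val x.
Proof. by have := le_trans (admissible_ge0 _) (prox_le x); rewrite lee_fin. Qed.

Lemma prox_valE x : j (prox x) = (prox_val x)%:E.
Proof.
apply/eqP; rewrite eq_le prox_le /=.
have := prox_le x; have := admissible_ge0 (prox x).
case E : (j (prox x)) => [r| |]// _ _; rewrite lee_fin lerBlDr.
by apply: moreau_env_leD; rewrite E.
Qed.

Definition residual x := x - prox x.

(* First-order optimality of [prox x], by letting the weight of [y] tend to [0]. *)
Lemma prox_variational x y r : (j y <= r%:E)%E ->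
  prox_val x + c * residual x * (y - prox x) <= r.
Proof.
rewrite /residual => jy; apply/ler_addgt0Pr => e e0; set D := (y - prox x) ^+ 2.
have D0 : 0 <= D by exact: sqr_ge0.
have cD0 : 0 < c * (D + 1) by rewrite mulr_gt0// ltr_wpDl.
pose t := Num.min (2^-1) (e / (c * (D + 1))).
have t0 : 0 < t by rewrite lt_min invr_gt0 divr_gt0// ltr0n.
have t1 : t < 1 by rewrite gt_min (_ : 2^-1 < 1 = true)//; lra.
have tD : t * (c * D) <= e.
  have : t * (c * (D + 1)) <= e by rewrite -ler_pdivlMr// ge_min lexx orbT.
  by apply: le_trans; rewrite ler_pM2l// ler_pM2l// lerDl.
have := moreau_env_leD x (admissible_convex (introT andP (conj t0 t1)) jy (prox_le x)).
have -> : env x = prox_val x + c / 2 * (x - prox x) ^+ 2 by rewrite subrK.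
move: (prox_val x) => V; rewrite /D in tD; clearbody t; clear D D0 cD0.
move: (prox x) tD => P tD env_le; rewrite -(ler_pM2l t0).
have : t * (t * (c * (y - P) ^+ 2)) <= t * e by rewrite ler_pM2l.
have : 0 <= t * (t * (c * (y - P) ^+ 2)).
  by do 3 (apply: mulr_ge0; first exact: ltW); exact: sqr_ge0.
by nra.
Qed.

Lemma residual_firmly_nonexpansive : firmly_nonexpansive residual.
Proof.
move=> x z; have := prox_variational x (prox_le z).
have := prox_variational z (prox_le x); rewrite /residual.
move: (prox x) (prox z) (prox_val x) (prox_val z) => P Q V W le_V le_W.
have : 0 <= c * ((x - P - (z - Q)) * (P - Q)) by lra.
by rewrite pmulr_rge0//; lra.
Qed.

Lemma residual0 : residual 0 = 0.
Proof.
have : (j 0 <= 0%:E)%E by rewrite admissible0.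
move=> /(prox_variational 0); have := prox_val_ge0 0; rewrite /residual !sub0r.
move=> V0 V_le; have : c * prox 0 ^+ 2 <= 0 by nra.
rewrite pmulr_rle0// => P2; have : prox 0 ^+ 2 == 0 by rewrite eq_le P2 sqr_ge0.
by rewrite sqrf_eq0 => /eqP ->; rewrite oppr0.
Qed.

Lemma measurable_residual : measurable_fun setT residual.
Proof. exact: firmly_nonexpansive_measurable residual_firmly_nonexpansive. Qed.

Lemma moreau_env_subgradient : subgradient env (fun x => c * residual x).
Proof.
move=> z x; have := prox_variational x (prox_le z); rewrite /prox_val /residual.
move: (env x) (env z) (prox x) (prox z) => E F P Q.
by have := mulr_ge0 (ltW c0) (sqr_ge0 ((z - Q) - (x - P))); nra.
Qed.

Lemma residual_sqr_le x : c / 2 * residual x ^+ 2 <= env x.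
Proof. by rewrite -subr_ge0; exact: prox_val_ge0. Qed.

Lemma moreau_env_ge0 x : 0 <= env x.
Proof. exact: le_trans (penalty_ge0 _ _) (residual_sqr_le x). Qed.

Lemma moreau_env_le_sqr x : env x <= c / 2 * x ^+ 2.
Proof.
have : (j 0 <= 0%:E)%E by rewrite admissible0.
by move=> /(moreau_env_leD x); rewrite subr0 add0r.
Qed.

Lemma moreau_env_le_fun x : ((env x)%:E <= j x)%E.
Proof.
have := admissible_ge0 x; case E : (j x) => [r| |]// _; rewrite ?leey// lee_fin.
by apply: (@moreau_env_le x x); apply: penalized_id; rewrite E.
Qed.

Lemma prox_le_moreau_env x : (j (prox x) <= (env x)%:E)%E.
Proof. by apply: le_trans (prox_le x) _; rewrite lee_fin gerBl penalty_ge0. Qed.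

Lemma measurable_moreau_env : measurable_fun setT env.
Proof.
have -> : env = (fun x => fine (j (x - residual x)) + c / 2 * residual x ^+ 2).
  by apply/funext => x; rewrite /residual subKr prox_valE /= subrK.
apply: measurable_funD; last first.
  by apply: measurable_funM => //; apply: measurable_funX; exact: measurable_residual.
apply: measurableT_comp; first exact: fine_measurable.
apply: measurableT_comp; first exact: measurable_admissible.
by apply: measurable_funB => //; exact: measurable_residual.
Qed.

End fixed_parameter.

Lemma moreau_env_homo c c' x : 0 < c -> c <= c' -> moreau_env c x <= moreau_env c' x.
Proof.
move=> c0 cc'; apply: lb_le_inf.
  by have [] := penalized_bounded_below (lt_le_trans c0 cc') x.
move=> r [y y_r]; apply: (moreau_env_le c0 (y := y)); apply: le_trans y_r _.
by rewrite lee_fin lerB// ler_wpM2r ?sqr_ge0// ler_pM2r.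
Qed.

Lemma nondecreasing_moreau_env x : nondecreasing_seq (fun n => moreau_env n.+1%:R x).
Proof. by move=> n k nk; apply: moreau_env_homo => //; rewrite ler_nat. Qed.

Lemma cvg_prox x a (n0 : forall n, 0 < n.+1%:R :> R) :
  (forall n, moreau_env n.+1%:R x <= a) -> prox (n0 n) x @[n --> \oo] --> x.
Proof.
move=> env_a; apply/cvgrPdist_lt => e e0.
have a0 : 0 < 2 * a + 1.
  by have := le_trans (moreau_env_ge0 (n0 0%N) x) (env_a 0%N); lra.
have e2 : 0 < e ^+ 2 / (2 * a + 1) by rewrite divr_gt0 ?exprn_gt0.
near=> n; have : n.+1%:R^-1 < e ^+ 2 / (2 * a + 1).
  by near: n; exact: near_infty_natSinv_lt (PosNum e2).
rewrite ltr_pdivlMr// => n_e.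
have := le_trans (residual_sqr_le (n0 n) x) (env_a n); rewrite /residual.
move: (x - prox (n0 n) x) => t t_le.
have t2_le : t ^+ 2 <= 2 * a * n.+1%:R^-1 by rewrite ler_pdivlMr//; lra.
rewrite -ltr_sqr ?nnegrE ?(ltW e0)// real_normK ?num_real//.
have : 0 < n.+1%:R^-1 :> R by rewrite invr_gt0.
by move: (n.+1%:R^-1) n_e t2_le => w; lra.
Unshelve. all: by end_near. Qed.

Lemma le_lim_moreau_env x : (j x <= limn (fun n => (moreau_env n.+1%:R x)%:E))%E.
Proof.
have n0 n : 0 < n.+1%:R :> R by rewrite ltr0n.
have nd : nondecreasing_seq (fun n => (moreau_env n.+1%:R x)%:E).
  by move=> n k nk; rewrite lee_fin; exact: nondecreasing_moreau_env.
have env_le n : ((moreau_env n.+1%:R x)%:E <= limn (fun n => (moreau_env n.+1%:R x)%:E))%E.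
  rewrite (cvg_lim _ (ereal_nondecreasing_cvgn nd))//.
  by apply: ereal_sup_ubound; exists n.
case: (limn _) env_le => [a| |] env_le; rewrite ?leey//; last by have := env_le 0%N.
have env_a n : moreau_env n.+1%:R x <= a by rewrite -lee_fin.
apply: (admissible_le_lim (cvg_prox n0 env_a) (cvg_cst a)) => n.
by apply: le_trans (prox_le_moreau_env (n0 n) x) _; rewrite lee_fin.
Qed.

End moreau.

(** * Subdifferentials of functionals on L^2 *)

Section functionals.
Context {d : measure_display} {X : measurableType d} {R : realType}.
Variable nu : {measure set X -> \bar R}.
Implicit Types (F G J : (X -> R) -> \bar R) (u v w h : X -> R) (T : R -> R).

Lemma subdiff_add F G u v1 v2 : subdiff nu F u v1 -> subdiff nu G u v2 ->
  subdiff nu (fun u => F u + G u)%E u (v1 \+ v2).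
Proof.
move=> [u2 [v12 [Fu sub1]]] [_ [v22 [Gu sub2]]].
split=> //; split; first exact: L2D.
split; first exact: lte_add_pinfty.
move=> w w2; have wu2 := L2B w2 u2; have i1 := L2_mul v12 wu2; have i2 := L2_mul v22 wu2.
have -> : (\int[nu]_x ((v1 \+ v2) x * (w x - u x))%:E =
    \int[nu]_x (v1 x * (w x - u x))%:E + \int[nu]_x (v2 x * (w x - u x))%:E)%E.
  rewrite -integralD_EFin//.
  by apply: eq_integral => x _; rewrite /= mulrDl EFinD.
by rewrite addeACA; apply: leeD; [exact: sub1|exact: sub2].
Qed.

Lemma eq_subdiff F G : (forall u, L2 nu u -> F u = G u) -> subdiff nu F = subdiff nu G.
Proof.
move=> FG; wlog suff sub_le : F G FG / forall u v, subdiff nu F u v -> subdiff nu G u v.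
  apply/funext => u; apply/funext => v; apply/propext; split; first exact: sub_le.
  by apply: sub_le => w w2; rewrite FG.
move=> u v [u2 [v2 [Fu sub]]]; split=> //; split=> //.
by split=> [|w w2]; rewrite -!FG//; exact: sub.
Qed.

Lemma eq_ae_subdiff F u v v' : L2 nu v' ->
  {ae nu, forall x, v x = v' x} -> subdiff nu F u v -> subdiff nu F u v'.
Proof.
move=> v'2 vv' [u2 [v2 [Fu sub]]]; split=> //; split=> //; split=> // w w2.
have wu2 := L2B w2 u2; have i := L2_mul v2 wu2; have i' := L2_mul v'2 wu2.
have := sub w w2; congr (_ + _ <= _)%E.
rewrite !rintegralE//; congr EFin; apply: eq_ae_Rintegral.
- exact: rintegrable_measurable i.
- exact: rintegrable_measurable i'.
- by apply: filterS vv' => x ->.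
Qed.

Definition convex_functional F := forall u w (t : R), L2 nu u -> L2 nu w -> 0 <= t <= 1 ->
  (F (fun x => ((1 - t) * u x + t * w x)%R) <= (1 - t)%:E * F u + t%:E * F w)%E.

(* [D] bounds from above the one-sided derivative of [J] at [u] in the direction [h]. *)
Lemma subdiff_add_directional G J u v h (D_ : R^nat) (D : R) :
  (forall u, (0 <= G u)%E) -> (forall u, (0 <= J u)%E) -> convex_functional G ->
  subdiff nu (fun u => G u + J u)%E u v -> L2 nu h ->
  (forall n, (J (fun x => u x + n.+1%:R^-1 * h x)%R <= J u + (n.+1%:R^-1 * D_ n)%:E)%E) ->
  D_ n @[n --> \oo] --> D ->
  (G u + (\int[nu]_x (v x * h x))%:E <= G (fun x => (u x + h x)%R) + D%:E)%E.
Proof.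
move=> G0 J0 G_convex [u2 [v2 [Fu sub]]] h2 J_le D_D.
have Gu : G u \is a fin_num.
  by rewrite ge0_fin_numE// (le_lt_trans _ Fu)// leeDl.
have Ju : J u \is a fin_num.
  by rewrite ge0_fin_numE// (le_lt_trans _ Fu)// leeDr.
have [Guh|] := boolP (G (fun x => (u x + h x)%R) < +oo)%E; last first.
  by rewrite -leNgt leye_eq => /eqP ->; rewrite addye// leey.
have {}Guh : G (fun x => u x + h x) \is a fin_num by rewrite ge0_fin_numE.
have vh := L2_mul v2 h2; rewrite -(fineK Gu) -(fineK Guh) -!EFinD lee_fin.
have quotient n : fine (G u) + \int[nu]_x (v x * h x) <=
    fine (G (fun x => u x + h x)) + D_ n.
  set t : R := n.+1%:R^-1; have t0 : 0 < t by rewrite invr_gt0.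
  have t01 : 0 <= t <= 1 by rewrite ltW//= invf_le1 ?ler1n.
  have := sub _ (L2D u2 (L2Z t h2)).
  have -> : (\int[nu]_x (v x * (u x + t * h x - u x))%:E =
      (t * \int[nu]_x (v x * h x))%:E)%E.
    rewrite -RintegralZl// -rintegralE; last exact: rintegrableZl.
    by apply: eq_integral => x _; congr EFin; ring.
  move=> /le_trans/(_ (leeD (lexx _) (J_le n))).
  have -> : (fun x => u x + t * h x) = (fun x => (1 - t) * u x + t * (u x + h x)).
    by apply/funext => x; ring.
  move=> /le_trans/(_ (leeD (G_convex _ _ _ u2 (L2D u2 h2) t01) (lexx _))).
  rewrite -(fineK Gu) -(fineK Guh) -(fineK Ju) -!EFinM -!EFinD lee_fin -/t.
  by move=> main; rewrite -(ler_pM2l t0); lra.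
have lim_D : fine (G (fun x => u x + h x)) + D_ n @[n --> \oo] -->
    fine (G (fun x => u x + h x)) + D by apply: cvgD => //; exact: cvg_cst.
by apply: (cvgr_to_ge lim_D); exact: nearW.
Qed.

Definition exchange_contracting F := forall T u1 u2,
  firmly_nonexpansive T -> T 0 = 0 -> L2 nu u1 -> L2 nu u2 ->
  (F (fun x => (u1 x - T (u1 x - u2 x))%R) + F (fun x => (u2 x + T (u1 x - u2 x))%R) <=
   F u1 + F u2)%E.

Lemma exchange_contractingD F G : exchange_contracting F -> exchange_contracting G ->
  exchange_contracting (fun u => F u + G u)%E.
Proof.
move=> exF exG T u1 u2 T_firm T0 u12 u22.
by rewrite addeACA [leRHS]addeACA; apply: leeD; [exact: exF|exact: exG].
Qed.

Lemma integral_moreau_env_le j (a b : X -> R) (lam c : R) (hj : admissible_j j)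
    (c0 : 0 < c) : L2 nu a -> L2 nu b -> 0 < lam ->
  0 <= \int[nu]_x (b x * residual hj c0 (a x)) ->
  (\int[nu]_x (moreau_env j c (a x))%:E <=
   \int[nu]_x (moreau_env j c (a x + lam * b x))%:E)%E.
Proof.
move=> a2 b2 lam0 acc.
have env_int g : L2 nu g -> rintegrable nu (fun x => moreau_env j c (g x)).
  move=> /L2P[mg g2]; apply: rintegrable_le (rintegrableZl (c / 2) g2) _.
    exact: measurableT_comp (measurable_moreau_env hj c0) mg.
  by move=> x; rewrite ger0_norm ?moreau_env_ge0// moreau_env_le_sqr.
have f2 : L2 nu (fun x => a x + lam * b x) by exact: L2D a2 (L2Z lam b2).
have res2 : L2 nu (fun x => residual hj c0 (a x)).
  apply: L2_firmly_nonexpansive (residual0 hj c0) a2.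
  exact: residual_firmly_nonexpansive.
have res_b := L2_mul b2 res2; have slope := rintegrableZl (c * lam) res_b.
have env_a := env_int _ a2; have env_f := env_int _ f2.
rewrite !rintegralE// lee_fin.
apply: (@le_trans _ _ (\int[nu]_x (moreau_env j c (a x) +
    c * lam * (b x * residual hj c0 (a x))))).
  rewrite RintegralD ?RintegralZl//.
  by rewrite lerDl mulr_ge0// mulr_ge0// ltW.
apply: le_Rintegral => //; first exact: rintegrableD.
move=> x _; have := moreau_env_subgradient hj c0 (a x + lam * b x) (a x).
by congr (_ + _ <= _); ring.
Qed.

Lemma le_integral_of_moreau_env j (a f : X -> R) : admissible_j j ->
  measurable_fun setT a -> measurable_fun setT f ->
  (forall n, (\int[nu]_x (moreau_env j n.+1%:R (a x))%:E <=
    \int[nu]_x (moreau_env j n.+1%:R (f x))%:E)%E) ->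
  (\int[nu]_x j (a x) <= \int[nu]_x j (f x))%E.
Proof.
move=> hj ma mf env_le; have n0 n : 0 < n.+1%:R :> R by [].
have env0 n t : (0 <= (moreau_env j n.+1%:R t)%:E)%E by rewrite lee_fin moreau_env_ge0.
have menv n g : measurable_fun setT g ->
    measurable_fun setT (fun x : X => (moreau_env j n.+1%:R (g x))%:E).
  by move=> mg; apply/measurable_EFinP;
    exact: measurableT_comp (measurable_moreau_env hj (n0 n)) mg.
have mj g : measurable_fun setT g -> measurable_fun setT (fun x : X => j (g x)).
  exact: measurableT_comp (measurable_admissible hj).
have nd x : nondecreasing_seq (fun n => (moreau_env j n.+1%:R (a x))%:E).
  by move=> n k nk; rewrite lee_fin; exact: nondecreasing_moreau_env.
apply: (@le_trans _ _ (\int[nu]_x limn (fun n => (moreau_env j n.+1%:R (a x))%:E))%E).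
  apply: ge0_le_integral => //.
  - by move=> x _; exact: admissible_ge0.
  - exact: mj.
  - apply: (emeasurable_fun_cvg (fun n x => (moreau_env j n.+1%:R (a x))%:E)).
      by move=> n; exact: menv.
    by move=> x _; exact: ereal_nondecreasing_is_cvgn.
  - by move=> x _; exact: le_lim_moreau_env.
rewrite monotone_convergence//; last by move=> n; exact: menv.
apply: lime_le; last first.
  apply: nearW => n; apply: le_trans (env_le n) _.
  apply: ge0_le_integral => //; [exact: menv|exact: mj|].
  by move=> x _; exact: moreau_env_le_fun.
apply: ereal_nondecreasing_is_cvgn => n k nk.
apply: ge0_le_integral => //; [exact: menv|exact: menv|].
by move=> x _; exact: nd.
Qed.

Section accretivity.
Variable F : (X -> R) -> \bar R.
Hypotheses (F_ge0 : forall u, (0 <= F u)%E) (F_exchange : exchange_contracting F).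

Lemma subdiff_accretive T u1 v1 u2 v2 : firmly_nonexpansive T -> T 0 = 0 ->
  subdiff nu F u1 v1 -> subdiff nu F u2 v2 ->
  0 <= \int[nu]_x ((v1 x - v2 x) * T (u1 x - u2 x)).
Proof.
move=> T_firm T0 [u12 [v12 [Fu1 sub1]]] [u22 [v22 [Fu2 sub2]]].
have Tu2 : L2 nu (fun x => T (u1 x - u2 x)).
  by apply: L2_firmly_nonexpansive => //; exact: L2B.
have i1 := L2_mul v12 Tu2; have i2 := L2_mul v22 Tu2.
have := le_trans (leeD (sub1 _ (L2B u12 Tu2)) (sub2 _ (L2D u22 Tu2)))
  (F_exchange T_firm T0 u12 u22).
have -> : (\int[nu]_x (v1 x * (u1 x - T (u1 x - u2 x) - u1 x))%:E =
    (- \int[nu]_x (v1 x * T (u1 x - u2 x)))%:E)%E.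
  rewrite -RintegralN// -rintegralE; last exact: rintegrableN.
  by apply: eq_integral => x _; congr EFin; ring.
have -> : (\int[nu]_x (v2 x * (u2 x + T (u1 x - u2 x) - u2 x))%:E =
    (\int[nu]_x (v2 x * T (u1 x - u2 x)))%:E)%E.
  by rewrite -rintegralE//; apply: eq_integral => x _; congr EFin; ring.
have /fineK <- : F u1 \is a fin_num by rewrite ge0_fin_numE.
have /fineK <- : F u2 \is a fin_num by rewrite ge0_fin_numE.
rewrite -!EFinD lee_fin => main; under eq_Rintegral do rewrite mulrBl.
by rewrite RintegralB//; lra.
Qed.

(* Use accretivity with [T := residual], a multiple of the derivative of a Moreau envelope. *)
Lemma subdiff_completely_accretive : completely_accretive nu (subdiff nu F).
Proof.
move=> lam lam0 u1 v1 u2 v2 D1 D2 j hj.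
have [u12 [v12 _]] := D1; have [u22 [v22 _]] := D2.
have a2 := L2B u12 u22; have b2 := L2B v12 v22.
apply: (le_integral_of_moreau_env hj (L2_measurable a2)).
  exact: L2_measurable (L2D a2 (L2Z lam b2)).
move=> n; have n0 : 0 < n.+1%:R :> R by [].
apply: (integral_moreau_env_le (hj := hj) (c0 := n0) a2 b2 lam0).
apply: subdiff_accretive D1 D2; last exact: residual0.
exact: residual_firmly_nonexpansive.
Qed.

End accretivity.

End functionals.

(** * The measure dm_x(y) dnu(x) on X * X *)

Section graph_measure.
Context {d : measure_display} {X : measurableType d} {R : realType}.
Variables (nu : {measure set X -> \bar R}) (m : X -> probability X R).
Hypothesis hm : kernel_measurable m.
Implicit Types (f : X * X -> \bar R) (C : set (X * X)).
Local Open Scope ereal_scope.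

Let walk_kernel (x : X) : {measure set X -> \bar R} := m x.

HB.instance Definition _ := isKernel.Build _ _ X X R walk_kernel hm.

Let walk_kernelT x : walk_kernel x setT = 1. Proof. exact: probability_setT. Qed.

HB.instance Definition _ := Kernel_isProbability.Build _ _ X X R walk_kernel walk_kernelT.

Lemma measurable_kernel_integral f : (forall z, 0 <= f z) ->
  measurable_fun setT f ->
  measurable_fun setT (fun x => \int[m x]_y f (x, y)).
Proof.
by move=> f0 mf; exact: (measurable_fun_integral_finite_kernel f walk_kernel f0 mf).
Qed.

Lemma measurable_EFin_indic C : measurable C ->
  measurable_fun setT (fun z : X * X => (\1_C z)%:E : \bar R).
Proof. by move=> mC; exact/measurable_EFinP/measurable_indic. Qed.

(* The dummy argument carries the proof that makes this set function a measure. *)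
Definition graph_mass (_ : kernel_measurable m) C : \bar R :=
  nuxm nu m (fun z => (\1_C z)%:E).

Let graph_mass0 : graph_mass hm set0 = 0.
Proof.
by apply: integral0_eq => x _; apply: integral0_eq => y _; rewrite indic0.
Qed.

Let graph_mass_ge0 C : 0 <= graph_mass hm C.
Proof.
by apply: integral_ge0 => x _; apply: integral_ge0 => y _; rewrite lee_fin.
Qed.

Let graph_mass_additive : semi_sigma_additive (graph_mass hm).
Proof.
move=> F mF tF mUF.
rewrite (_ : graph_mass hm (\bigcup_n F n)
    = \sum_(i <oo) graph_mass hm (F i)).
  by apply: is_cvg_ereal_nneg_natsum => i _.
rewrite /graph_mass /nuxm -integral_nneseries//=; last 2 first.
- move=> n; apply: measurable_kernel_integral (measurable_EFin_indic (mF n)).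
  by move=> z; rewrite lee_fin.
- by move=> n x _; apply: integral_ge0 => y _; rewrite lee_fin.
apply: eq_integral => x _; rewrite -integral_nneseries//.
- by apply: eq_integral => y _; rewrite indic_bigcup.
- by move=> n; exact: measurable_fun_pair2 (measurable_EFin_indic (mF n)).
Qed.

HB.instance Definition _ := isMeasure.Build _ _ R (graph_mass hm)
  graph_mass0 graph_mass_ge0 graph_mass_additive.

Definition graph_measure : {measure set (X * X) -> \bar R} := graph_mass hm.

Import HBNNSimple.

Let integral_graph_measure_indic (r : R) C : (0 <= r)%R -> measurable C ->
  \int[graph_measure]_z (r * \1_C z)%:E = nuxm nu m (fun z => (r * \1_C z)%:E).
Proof.
move=> r0 mC; have mI := measurable_EFin_indic mC.
under eq_integral do rewrite EFinM.
rewrite ge0_integralZl// integral_indic// setIT /= /graph_mass /nuxm.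
rewrite -ge0_integralZl//; last 2 first.
- by apply: measurable_kernel_integral mI => z; rewrite lee_fin.
- by move=> x _; apply: integral_ge0 => y _; rewrite lee_fin.
apply: eq_integral => x _; rewrite -ge0_integralZl//.
exact: measurable_fun_pair2 mI.
Qed.

Let integral_graph_measure_nnsfun (f : {nnsfun (X * X) >-> R}) :
  \int[graph_measure]_z (f z)%:E = nuxm nu m (fun z => (f z)%:E).
Proof.
pose f_ r z := (r * \1_(f @^-1` [set r]) z)%:E.
have mf_ r : measurable_fun setT (f_ r).
  rewrite /f_; under eq_fun do rewrite EFinM.
  exact: measurable_funeM (measurable_EFin_indic _).
have f_ge0 r z : 0 <= f_ r z by rewrite /f_ EFinM nnfun_muleindic_ge0.
have fE z : (f z)%:E = \sum_(r \in range f) f_ r z by rewrite fimfunE -fsumEFin.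
under eq_integral do rewrite fE.
rewrite ge0_integral_fsum//; transitivity (\sum_(r \in range f) nuxm nu m (f_ r)).
  apply: eq_fsbigr => r _; have [r0|r0] := leP 0%R r.
    exact: integral_graph_measure_indic.
  have f_0 z : f_ r z = 0 by rewrite /f_ preimage_nnfun0// indic0 mulr0.
  rewrite integral0_eq//; apply/esym/integral0_eq => x _.
  by apply: integral0_eq => y _; rewrite f_0.
rewrite /nuxm -ge0_integral_fsum//; last 2 first.
- by move=> r; exact: measurable_kernel_integral (f_ge0 r) (mf_ r).
- by move=> r x _; exact: integral_ge0.
apply: eq_integral => x _; rewrite -ge0_integral_fsum//.
- by apply: eq_integral => y _; rewrite fE.
- by move=> r; exact: measurable_fun_pair2 (mf_ r).
Qed.

Lemma ge0_integral_graph_measure f : (forall z, 0 <= f z) -> measurable_fun setT f ->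
  \int[graph_measure]_z f z = nuxm nu m f.
Proof.
move=> f0 mf; pose f_ := nnsfun_approx measurableT mf.
have f_f z : (f_ n z)%:E @[n --> \oo] --> f z by exact: cvg_nnsfun_approx.
have mf_ n : measurable_fun setT (fun z => (f_ n z)%:E) by exact/measurable_EFinP.
have ndf_ z : nondecreasing_seq (fun n => (f_ n z)%:E).
  by move=> a b ab; rewrite lee_fin; exact/lefP/nd_nnsfun_approx.
have limE z : f z = limn (fun n => (f_ n z)%:E) by apply/esym/cvg_lim.
under eq_integral do rewrite limE.
rewrite monotone_convergence//; last by move=> n z _; rewrite lee_fin.
under eq_fun do rewrite integral_graph_measure_nnsfun.
rewrite /nuxm -monotone_convergence//; last 3 first.
- move=> n; apply: measurable_kernel_integral (mf_ n).
  by move=> z; rewrite lee_fin.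
- by move=> n x _; apply: integral_ge0 => y _; rewrite lee_fin.
- move=> x _ a b ab; apply: ge0_le_integral => //.
  + by move=> y _; rewrite lee_fin.
  + exact: measurable_fun_pair2 (mf_ a).
  + exact: measurable_fun_pair2 (mf_ b).
  + by move=> y _; exact: ndf_.
apply: eq_integral => x _; rewrite -monotone_convergence//.
- by apply: eq_integral => y _; rewrite limE.
- by move=> n; exact: measurable_fun_pair2 (mf_ n).
- by move=> n y _; rewrite lee_fin.
Qed.

End graph_measure.

Section random_walk.
Context {d : measure_display} {X : measurableType d} {R : realType}.
Variables (nu : {measure set X -> \bar R}) (m : X -> probability X R).
Hypotheses (hm : kernel_measurable m) (hrev : nu_reversible nu m).
Implicit Types (u v h : X -> R) (g : X * X -> R).

Local Notation M := (graph_measure nu hm).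

Let measurable_swap_pair : measurable_fun [set: X * X] swap_pair.
Proof. exact: measurable_swap. Qed.

Let graph_measure_swap (C : set (X * X)) : measurable C -> M C = pushforward M swap_pair C.
Proof. by move=> mC; exact: hrev. Qed.

Lemma rintegrable_swap g : rintegrable M g -> rintegrable M (fun z => g (z.2, z.1)).
Proof.
move=> gi; have mg := rintegrable_measurable gi.
have mgs : measurable_fun setT (g \o swap_pair) by exact: measurableT_comp.
apply/integrableP; split; first exact/measurable_EFinP.
have /integrableP[_] := gi; congr (_ < _)%E.
rewrite (eq_measure_integral (pushforward M swap_pair)); last first.
  by move=> C mC _; exact: graph_measure_swap.
rewrite ge0_integral_pushforward//.
by apply: (@measurableT_comp _ _ _ _ _ _ abse) => //; exact/measurable_EFinP.
Qed.

Lemma Rintegral_swap g : rintegrable M g -> \int[M]_z g (z.2, z.1) = \int[M]_z g z.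
Proof.
move=> gi; have mg := rintegrable_measurable gi; congr fine.
rewrite [RHS](eq_measure_integral (pushforward M swap_pair)); last first.
  by move=> C mC _; exact: graph_measure_swap.
rewrite (integral_pushforward measurable_swap_pair)//; first exact/measurable_EFinP.
exact: (rintegrable_swap gi).
Qed.

Lemma rintegrable_fst h : rintegrable nu h -> rintegrable M (fun z => h z.1).
Proof.
move=> hi; have mh := rintegrable_measurable hi.
have mh1 : measurable_fun setT (EFin \o (fun z : X * X => h z.1)).
  by apply/measurable_EFinP; exact: measurableT_comp measurable_fst.
apply/integrableP; split=> //.
rewrite ge0_integral_graph_measure//; last exact: measurableT_comp.
have /integrableP[_] := hi; congr (_ < _)%E.
by apply: eq_integral => x _ /=; rewrite integral_cst//= probability_setT mule1.
Qed.

Lemma rintegrable_snd h : rintegrable nu h -> rintegrable M (fun z => h z.2).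
Proof. by move=> /rintegrable_fst/rintegrable_swap. Qed.

Lemma L2_fst h : L2 nu h -> L2 M (fun z => h z.1).
Proof.
move=> /L2P[mh h2]; apply/L2P; split; first exact: measurableT_comp measurable_fst.
exact: rintegrable_fst h2.
Qed.

Lemma L2_snd h : L2 nu h -> L2 M (fun z => h z.2).
Proof.
move=> /L2P[mh h2]; apply/L2P; split; first exact: measurableT_comp measurable_snd.
exact: rintegrable_snd h2.
Qed.

Definition fiber_integral g (x : X) : R := \int[m x]_y g (x, y).

Section fiber_integral.
Variable g : X * X -> R.
Hypothesis mg : measurable_fun setT g.
Let Eg : X * X -> \bar R := EFin \o g.
Let mEg : measurable_fun setT Eg. Proof. exact/measurable_EFinP. Qed.
Let P x : \bar R := (\int[m x]_y (Eg^\+ (x, y)))%E.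
Let N x : \bar R := (\int[m x]_y (Eg^\- (x, y)))%E.
Let mP : measurable_fun setT P.
Proof.
by apply: (measurable_kernel_integral hm) => //; exact: measurable_funepos.
Qed.
Let mN : measurable_fun setT N.
Proof.
by apply: (measurable_kernel_integral hm) => //; exact: measurable_funeneg.
Qed.
Let fiberE x : (\int[m x]_y (g (x, y))%:E)%E = (P x - N x)%E.
Proof.
rewrite integralE; congr (_ - _)%E; apply: eq_integral => y _.
  by rewrite !funeposE.
by rewrite !funenegE.
Qed.

Lemma measurable_fiber_integral : measurable_fun setT (fiber_integral g).
Proof.
apply: measurableT_comp; first exact: fine_measurable.
by under eq_fun do rewrite fiberE; exact: emeasurable_funB.
Qed.

Hypothesis gi : rintegrable M g.

Let fiber_integrable (f : X * X -> \bar R) : measurable_fun setT f ->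
  (forall z, 0 <= f z)%E -> M.-integrable setT f ->
  nu.-integrable setT (fun x => \int[m x]_y f (x, y))%E.
Proof.
move=> mf f0 /integrableP[_ fi]; apply/integrableP; split.
  exact: (measurable_kernel_integral hm).
move: fi; rewrite ge0_integral_graph_measure//; last exact: measurableT_comp.
congr (_ < _)%E; apply: eq_integral => x _.
rewrite gee0_abs; last by apply: integral_ge0.
by apply: eq_integral => y _; rewrite gee0_abs.
Qed.

Let Pi : nu.-integrable setT P.
Proof.
by apply: fiber_integrable => //; [exact: measurable_funepos|exact: integrable_funepos].
Qed.

Let Ni : nu.-integrable setT N.
Proof.
by apply: fiber_integrable => //; [exact: measurable_funeneg|exact: integrable_funeneg].
Qed.

Lemma ae_rintegrable_fiber : {ae nu, forall x, rintegrable (m x) (fun y => g (x, y))}.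
Proof.
apply: filterS2 (integrable_ae measurableT Pi) (integrable_ae measurableT Ni).
move=> x /(_ I) Px /(_ I) Nx.
have mgx : measurable_fun setT (EFin \o (fun y => g (x, y))).
  by apply/measurable_EFinP; exact: measurable_fun_pair2 mg.
apply/integrableP; split=> //; apply/abse_integralP => //.
by rewrite -fin_num_abs /= fiberE fin_numB Px.
Qed.

Let fiber_ae : {ae nu, forall x, (P x - N x)%E = (fiber_integral g x)%:E}.
Proof. by apply: filterS ae_rintegrable_fiber => x gx; rewrite -fiberE rintegralE. Qed.

Lemma rintegrable_fiber_integral : rintegrable nu (fiber_integral g).
Proof.
apply/integrableP; split; first exact/measurable_EFinP/measurable_fiber_integral.
have /integrableP[_] := integrableB measurableT Pi Ni; congr (_ < _)%E.
apply: ge0_ae_eq_integral => //.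
- by apply: measurableT_comp => //; exact: emeasurable_funB.
- by apply: measurableT_comp => //; exact/measurable_EFinP/measurable_fiber_integral.
- by apply: filterS fiber_ae => x /= ->.
Qed.

Lemma Rintegral_fiber_integral : \int[nu]_x fiber_integral g x = \int[M]_z g z.
Proof.
congr fine; transitivity (\int[nu]_x (P \- N)%E x)%E.
  apply/esym/ae_eq_integral => //; first exact: emeasurable_funB.
    exact/measurable_EFinP/measurable_fiber_integral.
  by apply: filterS fiber_ae.
rewrite integralB// [RHS]integralE; congr (_ - _)%E.
- by rewrite ge0_integral_graph_measure//; exact: measurable_funepos.
- by rewrite ge0_integral_graph_measure//; exact: measurable_funeneg.
Qed.

End fiber_integral.

Lemma Rintegral_fst h : rintegrable nu h -> \int[M]_z h z.1 = \int[nu]_x h x.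
Proof.
move=> hi; have hi1 := rintegrable_fst hi.
rewrite -(Rintegral_fiber_integral (rintegrable_measurable hi1) hi1).
apply: eq_Rintegral => x _; transitivity (h x * fine (m x setT)).
  exact: (Rintegral_cst (m x) measurableT (h x)).
by rewrite probability_setT mulr1.
Qed.

Lemma Rintegral_snd h : rintegrable nu h -> \int[M]_z h z.2 = \int[nu]_x h x.
Proof.
by move=> hi; rewrite -Rintegral_fst//; exact: (Rintegral_swap (rintegrable_fst hi)).
Qed.

Lemma ae_L2_fiber g : L2 M g -> {ae nu, forall x, L2 (m x) (fun y => g (x, y))}.
Proof.
move=> /L2P[mg g2]; apply: filterS (ae_rintegrable_fiber (measurable_funX 2 mg) g2) => x gx2.
by apply/L2P; split=> //; exact: measurable_fun_pair2.
Qed.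

Lemma L2_fiber_integral g : L2 M g -> L2 nu (fiber_integral g).
Proof.
move=> /[dup] gL /L2P[mg g2]; have mg2 := rintegrable_measurable g2.
have mf := measurable_fiber_integral mg.
apply/L2P; split=> //; apply: ae_le_rintegrable (rintegrable_fiber_integral mg2 g2) _.
  exact: measurable_funX.
apply: filterS (ae_L2_fiber gL) => x gx.
by rewrite ger0_norm ?sqr_ge0//; exact: probability_sqr_Rintegral_le.
Qed.

Lemma ae_rintegrable_fiber_L2_plus_L1 g : L2_plus_L1 M g ->
  {ae nu, forall x, rintegrable (m x) (fun y => g (x, y))}.
Proof.
move=> [a [b [a2 bi ->]]]; have mb := rintegrable_measurable bi.
apply: filterS2 (ae_L2_fiber a2) (ae_rintegrable_fiber mb bi) => x ax bx.
apply: rintegrableD => //; apply/Lfun1_integrable; apply: Lfun_subset12.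
  exact: fin_num_measure.
exact/L2_Lfun.
Qed.

Lemma L2_plus_L1_fiber_integral g : L2_plus_L1 M g -> L2_plus_L1 nu (fiber_integral g).
Proof.
move=> gab; have mg := L2_plus_L1_measurable gab; have [a [b [a2 bi gE]]] := gab.
have ma := L2_measurable a2; have mb := rintegrable_measurable bi.
have bF := rintegrable_fiber_integral mb bi.
exists (fiber_integral a), (fun x => fiber_integral g x - fiber_integral a x).
split; [exact: L2_fiber_integral| |by apply/funext => x; rewrite addrC subrK].
apply: eq_ae_rintegrable bF.
  by apply: measurable_funB; exact: measurable_fiber_integral.
apply: filterS2 (ae_rintegrable_fiber_L2_plus_L1 gab) (ae_rintegrable_fiber mb bi).
move=> x gx bx; rewrite /fiber_integral.
have -> : (fun y => b (x, y)) = (fun y => g (x, y) - a (x, y)).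
  by apply/funext => y; rewrite gE addrC addKr.
rewrite RintegralB//; have := rintegrableB gx bx; congr (rintegrable _ _).
by apply/funext => y; rewrite gE addrK.
Qed.

Lemma measurable_grad u : measurable_fun setT u -> measurable_fun setT (grad u).
Proof.
move=> mu; apply: measurable_funB.
  exact: measurableT_comp measurable_snd.
exact: measurableT_comp measurable_fst.
Qed.

Section green_formula.
Variable g : X * X -> R.
Hypothesis g_anti : forall z, g (z.2, z.1) = - g z.

Lemma green_formula_integrable h : measurable_fun setT g ->
  rintegrable M (fun z => g z * h z.1) ->
  2^-1 * \int[M]_z (g z * grad h z) = - \int[nu]_x (fiber_integral g x * h x).
Proof.
move=> mg gh1.
have -> : (fun x => fiber_integral g x * h x) = fiber_integral (fun z => g z * h z.1).
  apply/funext => x; rewrite /fiber_integral mulrC -RintegralZl_measurable.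
    by apply: eq_Rintegral => y _; rewrite mulrC.
  exact: measurable_fun_pair2 mg.
rewrite (Rintegral_fiber_integral (rintegrable_measurable gh1) gh1).
have gh2 : rintegrable M (fun z => g z * h z.2).
  have := rintegrableN (rintegrable_swap gh1).
  by under eq_fun do rewrite g_anti mulNr opprK.
have := Rintegral_swap gh1; under eq_Rintegral do rewrite g_anti mulNr.
rewrite RintegralN// => swapE.
under eq_Rintegral do rewrite /grad mulrBr.
by rewrite RintegralB//; lra.
Qed.

Hypothesis gL : L2_plus_L1 M g.

(* Truncating [h] makes [g z * h z.1] integrable. *)
Lemma green_formula h : L2 nu (fiber_integral g) -> L2 nu h ->
  rintegrable M (fun z => g z * grad h z) ->
  2^-1 * \int[M]_z (g z * grad h z) = - \int[nu]_x (fiber_integral g x * h x).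
Proof.
move=> G2 h2 gdh; pose hn n x := clamp n%:R (h x).
have hn2 n : L2 nu (hn n) by exact: L2_clamp.
have mg := L2_plus_L1_measurable gL.
have green_n n : 2^-1 * \int[M]_z (g z * grad (hn n) z) =
    - \int[nu]_x (fiber_integral g x * hn n x).
  apply: green_formula_integrable => //.
  apply: (L2_plus_L1_mul gL (L2_fst (hn2 n)) (c := n%:R)) => z.
  exact: norm_clamp_le.
have firm n := clamp_firmly_nonexpansive (ler0n R n).
have lim_grad : \int[M]_z (g z * grad (hn n) z) @[n --> \oo] --> \int[M]_z (g z * grad h z).
  apply: (cvg_dominated_Rintegral _ _ (rintegrable_norm gdh)).
  - by move=> n; apply: measurable_funM => //; exact: measurable_grad (L2_measurable (hn2 n)).
  - by move=> z; apply: cvgM; [exact: cvg_cst|apply: cvgB; exact: cvg_clamp].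
  - by move=> n z; rewrite !normrM ler_wpM2l//; exact: (firmly_nonexpansive_dist (firm n)).
have lim_div : \int[nu]_x (fiber_integral g x * hn n x) @[n --> \oo] -->
    \int[nu]_x (fiber_integral g x * h x).
  apply: (cvg_dominated_Rintegral _ _ (rintegrable_norm (L2_mul G2 h2))).
  - move=> n; apply: measurable_funM; first exact: L2_measurable G2.
    exact: L2_measurable (hn2 n).
  - by move=> x; apply: cvgM; [exact: cvg_cst|exact: cvg_clamp].
  - move=> n x; rewrite !normrM ler_wpM2l//.
    exact: (firmly_nonexpansive_norm (firm n) _ (clamp0 (ler0n R n))).
have lim_half : 2^-1 * \int[M]_z (g z * grad (hn n) z) @[n --> \oo] -->
    2^-1 * \int[M]_z (g z * grad h z) by apply: cvgM => //; exact: cvg_cst.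
rewrite (funext green_n) in lim_half.
exact: (cvg_unique (@Rhausdorff R) lim_half (cvgN lim_div)).
Qed.

End green_formula.

End random_walk.

(** * Nonlocal gradient energies *)

Section conductance.
Context {d : measure_display} {X : measurableType d} {R : realType}.

Record conductance (K : X * X -> R) : Prop := Conductance {
  conductance_measurable : measurable_fun setT K;
  conductance_ge0 : forall z, 0 <= K z;
  conductance_le1 : forall z, K z <= 1;
  conductance_sym : forall z, K (z.2, z.1) = K z }.

Lemma conductance_Kset (A : X -> set X) :
  measurable [set z : X * X | A z.1 z.2] -> conductance (Kset A).
Proof.
set C := [set z : X * X | A z.1 z.2] => mC.
have ind_le1 (S : set X) x : \1_S x <= 1 :> R by rewrite indicE; case: (_ \in _).
split=> [|z|z|z].
- have mI : measurable_fun setT (\1_C : X * X -> R) by exact: measurable_indic.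
  apply: measurable_funM => //; apply: measurable_funD; first exact: mI.
  by apply: (measurableT_comp mI (g := swap_pair)); exact: measurable_swap.
- by rewrite mulr_ge0// addr_ge0.
- by rewrite /Kset; have := ind_le1 (A z.1) z.2; have := ind_le1 (A z.2) z.1; lra.
- by rewrite /Kset /= addrC.
Qed.

End conductance.

Section lipschitz_functional.
Context {d : measure_display} {X : measurableType d} {R : realType}.
Variable nu : {measure set X -> \bar R}.

Record lipschitz_functional (G : (X -> R) -> \bar R) : Prop := LipschitzFunctional {
  lipschitz_functional_ge0 : forall u, (0 <= G u)%E;
  lipschitz_functional_convex : convex_functional nu G;
  lipschitz_functional_clamp : forall c u, 0 <= c -> L2 nu u ->
    (G (fun x => clamp c (u x)) <= G u)%E;
  lipschitz_functionalD : forall u h, L2 nu u -> rintegrable nu h ->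
    (G (fun x => (u x + h x)%R) <= G u + (\int[nu]_x `|h x|)%:E)%E }.

Lemma lipschitz_functional0 : lipschitz_functional (fun=> 0%E).
Proof.
split=> // [u w t _ _ _|u h _ _]; first by rewrite !mule0 adde0.
by rewrite add0e lee_fin; exact: Rintegral_ge0.
Qed.

End lipschitz_functional.

Section edge_energy.
Context {d : measure_display} {X : measurableType d} {R : realType}.
Variables (nu : {measure set X -> \bar R}) (m : X -> probability X R).
Hypotheses (hm : kernel_measurable m) (hrev : nu_reversible nu m).
Variables (phi : R -> R) (K : X * X -> R).
Hypotheses (mphi : measurable_fun setT phi) (phi_ge0 : forall t, 0 <= phi t).
Hypothesis K_cond : conductance K.
Implicit Types (u v w h : X -> R).

Local Notation M := (graph_measure nu hm).
Local Notation density u := (fun z => phi (grad u z) * K z).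

Let K_ge0 := conductance_ge0 K_cond.
Let mK := conductance_measurable K_cond.

Definition edge_energy u : \bar R :=
  ((2^-1)%:E * nuxm nu m (fun z => (density u z)%:E))%E.

Lemma density_ge0 u z : 0 <= density u z.
Proof. exact: mulr_ge0. Qed.

Lemma measurable_density u : measurable_fun setT u -> measurable_fun setT (density u).
Proof.
move=> mu; apply: measurable_funM => //.
exact: measurableT_comp (measurable_grad mu).
Qed.

Lemma edge_energyE u : measurable_fun setT u ->
  edge_energy u = ((2^-1)%:E * \int[M]_z (density u z)%:E)%E.
Proof.
move=> mu; congr (_ * _)%E; apply/esym/ge0_integral_graph_measure.
  by move=> z; rewrite lee_fin density_ge0.
by apply/measurable_EFinP; exact: measurable_density.
Qed.

Lemma edge_energy_ge0 u : (0 <= edge_energy u)%E.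
Proof.
apply: mule_ge0; first by rewrite lee_fin.
by apply: integral_ge0 => x _; apply: integral_ge0 => y _; rewrite lee_fin density_ge0.
Qed.

Lemma edge_energy_fin u : measurable_fun setT u -> rintegrable M (density u) ->
  edge_energy u = (2^-1 * \int[M]_z (density u z))%:E.
Proof. by move=> mu ui; rewrite edge_energyE// rintegralE// EFinM. Qed.

Lemma edge_energy_ltyP u : measurable_fun setT u ->
  (edge_energy u < +oo)%E <-> rintegrable M (density u).
Proof.
move=> mu; split=> [|ui]; last by rewrite edge_energy_fin// ltry.
rewrite edge_energyE// => uy; apply: ge0_rintegrable => [|z|].
- exact: measurable_density.
- exact: density_ge0.
- by move: uy; rewrite !ltey; apply: contra => /eqP ->; rewrite gt0_muley ?lte_fin.
Qed.

Let le_half_integral (f g : X * X -> R) : measurable_fun setT f -> measurable_fun setT g ->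
  (forall z, 0 <= f z) -> (forall z, f z <= g z) ->
  ((2^-1)%:E * \int[M]_z (f z)%:E <= (2^-1)%:E * \int[M]_z (g z)%:E)%E.
Proof.
move=> mf mg f0 fg; rewrite lee_wpmul2l ?lee_fin//; apply: ge0_le_integral => //.
- by move=> z _; rewrite lee_fin.
- exact/measurable_EFinP.
- exact/measurable_EFinP.
- by move=> z _; rewrite lee_fin.
Qed.

Let half_integralD (f g : X * X -> R) : measurable_fun setT f -> measurable_fun setT g ->
  (forall z, 0 <= f z) -> (forall z, 0 <= g z) ->
  ((2^-1)%:E * \int[M]_z (f z)%:E + (2^-1)%:E * \int[M]_z (g z)%:E =
   (2^-1)%:E * \int[M]_z (f z + g z)%:E)%E.
Proof.
move=> mf mg f0 g0; under [in RHS]eq_integral do rewrite EFinD.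
rewrite ge0_integralD//; first last.
- exact/measurable_EFinP.
- by move=> z _; rewrite lee_fin.
- exact/measurable_EFinP.
- by move=> z _; rewrite lee_fin.
by apply/esym/ge0_muleDr; apply: integral_ge0 => z _; rewrite lee_fin.
Qed.

Lemma edge_energyZ (a : R) u : 0 <= a -> measurable_fun setT u ->
  (a%:E * edge_energy u = (2^-1)%:E * \int[M]_z (a * density u z)%:E)%E.
Proof.
move=> a0 mu; rewrite edge_energyE// muleCA; congr (_ * _)%E.
rewrite -ge0_integralZl_EFin// => [z _|].
  by rewrite lee_fin density_ge0.
by apply/measurable_EFinP; exact: measurable_density.
Qed.

Lemma le_edge_energy u w : measurable_fun setT u -> measurable_fun setT w ->
  (forall z, phi (grad u z) <= phi (grad w z)) -> (edge_energy u <= edge_energy w)%E.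
Proof.
move=> mu mw uw; rewrite !edge_energyE//; apply: le_half_integral => [||z|z].
- exact: measurable_density.
- exact: measurable_density.
- exact: density_ge0.
- by rewrite ler_wpM2r.
Qed.

Lemma edge_energy_convex : convexR phi -> convex_functional nu edge_energy.
Proof.
move=> phi_convex u w t u2 w2 t01; have mu := L2_measurable u2; have mw := L2_measurable w2.
have /andP[t0 t1] := t01; have t1' : 0 <= 1 - t by rewrite subr_ge0.
have muw : measurable_fun setT (fun x => (1 - t) * u x + t * w x).
  by apply: measurable_funD; exact: measurable_funM.
have mZ (r : R) v : measurable_fun setT v -> measurable_fun setT (fun z => r * density v z).
  by move=> mv; apply: measurable_funM => //; exact: measurable_density.
have Z0 (r : R) v z : 0 <= r -> 0 <= r * density v z.
  by move=> r0; rewrite mulr_ge0// density_ge0.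
rewrite !edge_energyZ// half_integralD//; [|exact: mZ|exact: mZ|by move=> z; exact: Z0..].
rewrite edge_energyE//; apply: le_half_integral => [||z|z].
- exact: measurable_density.
- by apply: measurable_funD; exact: mZ.
- exact: density_ge0.
rewrite !mulrA -mulrDl ler_wpM2r//; apply: le_trans (phi_convex _ _ _ t01).
by rewrite le_eqVlt; apply/orP; left; apply/eqP; congr phi; rewrite /grad; ring.
Qed.

Lemma edge_energy_exchange : convexR phi -> exchange_contracting nu edge_energy.
Proof.
move=> phi_convex T u1 u2 T_firm T0 u12 u22.
have mu1 := L2_measurable u12; have mu2 := L2_measurable u22.
have Tu2 := L2_firmly_nonexpansive T_firm T0 (L2B u12 u22).
set w1 := fun x => u1 x - T (u1 x - u2 x); set w2 := fun x => u2 x + T (u1 x - u2 x).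
have mw1 : measurable_fun setT w1 by exact: L2_measurable (L2B u12 Tu2).
have mw2 : measurable_fun setT w2 by exact: L2_measurable (L2D u22 Tu2).
have du1 := measurable_density mu1; have du2 := measurable_density mu2.
have dw1 := measurable_density mw1; have dw2 := measurable_density mw2.
have d0 v z : 0 <= density v z by exact: density_ge0.
rewrite !edge_energyE// !half_integralD//.
apply: le_half_integral => [||z|z]; [exact: measurable_funD..|exact: addr_ge0|].
rewrite -!mulrDl ler_wpM2r//.
have [th th01 slope] := firmly_nonexpansive_slope T_firm (u1 z.2 - u2 z.2) (u1 z.1 - u2 z.1).
have -> : grad w1 z = (1 - th) * grad u1 z + th * grad u2 z.
  transitivity (grad u1 z - (T (u1 z.2 - u2 z.2) - T (u1 z.1 - u2 z.1))).
    by rewrite /grad /w1; ring.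
  by rewrite slope /grad; ring.
have -> : grad w2 z = (1 - th) * grad u2 z + th * grad u1 z.
  transitivity (grad u2 z + (T (u1 z.2 - u2 z.2) - T (u1 z.1 - u2 z.1))).
    by rewrite /grad /w2; ring.
  by rewrite slope /grad; ring.
by have := phi_convex (grad u1 z) (grad u2 z) th th01;
  have := phi_convex (grad u2 z) (grad u1 z) th th01; lra.
Qed.

Hypothesis phi_lipschitz : forall s t, phi (s + t) <= phi s + `|t|.

Lemma edge_energy_lipschitz u h : measurable_fun setT u -> rintegrable nu h ->
  (edge_energy (fun x => (u x + h x)%R) <= edge_energy u + (\int[nu]_x `|h x|)%:E)%E.
Proof.
move=> mu hi; have mh := rintegrable_measurable hi; have nhi := rintegrable_norm hi.
have muh : measurable_fun setT (fun x => u x + h x) by exact: measurable_funD.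
have h1 := rintegrable_fst hm nhi; have h2 := rintegrable_snd hm hrev nhi.
have [uy|] := boolP (edge_energy u < +oo)%E; last first.
  by rewrite -leNgt leye_eq => /eqP ->; rewrite addye// leey.
have ui := (edge_energy_ltyP mu).1 uy.
have h12 := rintegrableD h1 h2; have dom := rintegrableD ui h12.
have le_dom z : density (fun x => u x + h x) z <= density u z + (`|h z.1| + `|h z.2|).
  have K0 := K_ge0 z; have K1 := conductance_le1 K_cond z.
  have -> : grad (fun x => u x + h x) z = grad u z + grad h z by rewrite /grad; ring.
  apply: le_trans (ler_wpM2r K0 (phi_lipschitz _ _)) _; rewrite mulrDl lerD2l.
  apply: le_trans (ler_piMr (normr_ge0 _) K1) _.
  by rewrite [leRHS]addrC; exact: ler_normB.
have uhi : rintegrable M (density (fun x => u x + h x)).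
  apply: rintegrable_le dom _; first exact: measurable_density.
  by move=> z; rewrite ger0_norm ?density_ge0.
rewrite !edge_energy_fin// -EFinD lee_fin.
have := le_Rintegral measurableT uhi dom (fun z _ => le_dom z).
rewrite RintegralD// RintegralD// (Rintegral_fst hm nhi) (Rintegral_snd hm hrev nhi).
by lra.
Qed.

Lemma lipschitz_functional_edge_energy : convexR phi ->
  (forall s t, `|s| <= `|t| -> phi s <= phi t) -> lipschitz_functional nu edge_energy.
Proof.
move=> phi_convex phi_norm; split.
- exact: edge_energy_ge0.
- exact: edge_energy_convex.
- move=> c u c0 u2; apply: le_edge_energy => [||z].
  + exact: L2_measurable (L2_clamp c0 u2).
  + exact: L2_measurable u2.
  + apply: phi_norm; apply: firmly_nonexpansive_dist; exact: clamp_firmly_nonexpansive.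
- by move=> u h u2; exact: edge_energy_lipschitz (L2_measurable u2).
Qed.

End edge_energy.
(** * The p-Laplacian *)

Section p_laplacian.
Context {d : measure_display} {X : measurableType d} {R : realType}.
Variables (nu : {measure set X -> \bar R}) (m : X -> probability X R).
Hypotheses (hm : kernel_measurable m) (hrev : nu_reversible nu m).
Variables (K : X * X -> R) (p : R).
Hypotheses (K_cond : conductance K) (p1 : 1 <= p).
Implicit Types (u v w h : X -> R).

Local Notation M := (graph_measure nu hm).
Local Notation E := (edge_energy nu m (ppow p) K).

Let K_ge0 z : 0 <= K z. Proof. exact: conductance_ge0. Qed.
Let K_le1 z : K z <= 1. Proof. exact: conductance_le1. Qed.
Let mK : measurable_fun setT K. Proof. exact: conductance_measurable. Qed.
Let phi_ge0 t : 0 <= ppow p t. Proof. exact: ppow_ge0. Qed.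

Definition pfinite u := rintegrable M (fun z => ppow p (grad u z) * K z).
Definition pflux u z : R := dppow p (grad u z) * K z.
Definition plap u : X -> R := fiber_integral m (pflux u).

Lemma p_energy_ltyP u : measurable_fun setT u -> (E u < +oo)%E <-> pfinite u.
Proof. exact: (edge_energy_ltyP nu hm (measurable_ppow p) phi_ge0 K_cond). Qed.

Lemma p_energy_fin u : measurable_fun setT u -> pfinite u ->
  E u = (2^-1 * \int[M]_z (ppow p (grad u z) * K z))%:E.
Proof. exact: (edge_energy_fin (measurable_ppow p) phi_ge0 K_cond). Qed.

Lemma p_energy_ge0 u : (0 <= E u)%E.
Proof. exact: edge_energy_ge0. Qed.

Lemma measurable_p_density u : measurable_fun setT u ->
  measurable_fun setT (fun z => ppow p (grad u z) * K z).
Proof. exact: (measurable_density (measurable_ppow p) K_cond). Qed.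

Lemma p_density_ge0 u z : 0 <= ppow p (grad u z) * K z.
Proof. exact: mulr_ge0. Qed.

Lemma measurable_pflux u : measurable_fun setT u -> measurable_fun setT (pflux u).
Proof.
move=> mu; apply: measurable_funM => //.
exact: measurableT_comp (measurable_dppow p) (measurable_grad mu).
Qed.

Lemma measurable_plap u : measurable_fun setT u -> measurable_fun setT (plap u).
Proof. by move=> mu; apply: (measurable_fiber_integral hm); exact: measurable_pflux. Qed.

Lemma pflux_antisym u z : pflux u (z.2, z.1) = - pflux u z.
Proof. by rewrite /pflux (conductance_sym K_cond) -mulNr -dppowN /grad opprB. Qed.

Lemma pfiniteD u h (t : R) : measurable_fun setT u -> measurable_fun setT h ->
  `|t| <= 1 -> pfinite u -> pfinite h -> pfinite (fun x => u x + t * h x).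
Proof.
move=> mu mh t1 ui hi; apply: (rintegrable_le _ (rintegrableZl (2 `^ p) (rintegrableD ui hi))).
  by apply: measurable_p_density; apply: measurable_funD => //; exact: measurable_funM.
move=> z /=; rewrite ger0_norm ?p_density_ge0// -mulrDl mulrA ler_wpM2r//.
have -> : grad (fun x => u x + t * h x) z = grad u z + t * grad h z.
  by rewrite /grad; ring.
apply: le_trans (ppowD_le p1 _ _) _; rewrite ler_wpM2l ?powR_ge0// lerD2l.
by apply: ppow_le_norm => //; rewrite normrM ler_piMl.
Qed.

Lemma pfiniteB u h : measurable_fun setT u -> measurable_fun setT h ->
  pfinite u -> pfinite h -> pfinite (fun x => u x - h x).
Proof.
move=> mu mh ui hi; under eq_fun do rewrite -mulN1r.
by apply: pfiniteD => //; rewrite normrN1.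
Qed.

Lemma norm_pflux_grad_le u h z : `|pflux u z * grad h z| <=
  (p - 1) * (ppow p (grad u z) * K z) + ppow p (grad h z) * K z.
Proof.
rewrite /pflux mulrAC normrM (ger0_norm (K_ge0 z)) [X in _ <= X + _]mulrA -mulrDl.
by rewrite ler_wpM2r// dppow_young.
Qed.

Lemma rintegrable_pflux_grad u h : measurable_fun setT u -> measurable_fun setT h ->
  pfinite u -> pfinite h -> rintegrable M (fun z => pflux u z * grad h z).
Proof.
move=> mu mh ui hi; apply: rintegrable_le (rintegrableD (rintegrableZl (p - 1) ui) hi) _.
  by apply: measurable_funM; [exact: measurable_pflux|exact: measurable_grad].
exact: norm_pflux_grad_le.
Qed.

Lemma green_formula_plap u h : measurable_fun setT u -> pfinite u ->
  L2_plus_L1 M (pflux u) -> L2 nu (plap u) -> L2 nu h -> pfinite h ->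
  2^-1 * \int[M]_z (pflux u z * grad h z) = - \int[nu]_x (plap u x * h x).
Proof.
move=> mu ui fL lap2 h2 hi; apply: (green_formula hrev (pflux_antisym u) fL lap2 h2).
by apply: rintegrable_pflux_grad => //; exact: L2_measurable h2.
Qed.

Lemma p_energy_subgradient u w : measurable_fun setT u -> measurable_fun setT w ->
  pfinite u -> pfinite w ->
  (E u + (2^-1 * \int[M]_z (pflux u z * grad (fun x => w x - u x) z))%:E <= E w)%E.
Proof.
move=> mu mw ui wi; have mwu : measurable_fun setT (fun x => w x - u x).
  exact: measurable_funB.
have fi := rintegrable_pflux_grad mu mwu ui (pfiniteB mw mu wi ui).
rewrite !p_energy_fin// -EFinD lee_fin -mulrDr ler_wpM2l// -RintegralD//.
apply: le_Rintegral => //; first exact: rintegrableD.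
move=> z _; have := ler_wpM2r (K_ge0 z) (ppow_subgradient p1 (grad w z) (grad u z)).
by apply: le_trans; rewrite le_eqVlt; apply/orP; left; apply/eqP; rewrite /pflux /grad; ring.
Qed.

Lemma subdiff_p_energy_plap u : L2 nu u -> pfinite u -> L2_plus_L1 M (pflux u) ->
  L2 nu (plap u) -> subdiff nu E u (fun x => - plap u x).
Proof.
move=> u2 ui fL lap2; have mu := L2_measurable u2.
split=> //; split; first exact: L2N.
split=> [|w w2]; first exact/(p_energy_ltyP mu).
have mw := L2_measurable w2; have [wy|] := boolP (E w < +oo)%E; last first.
  by rewrite -leNgt leye_eq => /eqP ->; exact: leey.
have wi := (p_energy_ltyP mw).1 wy; have wu2 := L2B w2 u2.
apply: le_trans (p_energy_subgradient mu mw ui wi).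
rewrite (green_formula_plap mu ui fL lap2 wu2 (pfiniteB mw mu wi ui)).
have lap_wu := L2_mul lap2 wu2; rewrite -RintegralN// -rintegralE; last exact: rintegrableN.
by under [in leRHS]eq_integral do rewrite -mulNr.
Qed.

Section bounded_support.
Variables (S : set X) (c : R) (u : X -> R).
Hypotheses (mS : measurable S) (S_fin : (nu S < +oo)%E).
Hypotheses (mu : measurable_fun setT u) (u_le : forall x, `|u x| <= c * \1_S x).

Let cS2 (k : R) : L2 nu (fun x => k * \1_S x).
Proof. exact: L2Z (L2_indic mS S_fin). Qed.

Lemma bounded_support_L2 : L2 nu u.
Proof. by apply: L2_le mu (cS2 c) _ => x; rewrite (le_trans (u_le x))// ler_norm. Qed.

Lemma bounded_support_pflux_L2 : L2 M (pflux u).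
Proof.
pose k := (2 * `|c|) `^ (p - 1); have k0 : 0 <= k by exact: powR_ge0.
have dom := L2D (L2_fst hm (cS2 k)) (L2_snd hm hrev (cS2 k)).
apply: L2_le dom _ => [|z]; first exact: measurable_pflux.
have u_c x : `|u x| <= `|c|.
  apply: le_trans (u_le x) _; rewrite (le_trans (ler_norm _))// normrM ler_piMr//.
  by rewrite indicE; case: (_ \in _); rewrite ?normr0 ?normr1.
rewrite [leRHS]ger0_norm ?addr_ge0// ?mulr_ge0//.
have [gz|gz] := eqVneq (grad u z) 0.
  by rewrite /pflux gz /dppow mulr0 mul0r normr0 addr_ge0// mulr_ge0.
have S1 : 1 <= \1_S z.1 + \1_S z.2 :> R.
  have u0 x : \1_S x = 0 :> R -> u x = 0.
    by move=> Sx; apply/eqP; rewrite -normr_le0 (le_trans (u_le x))// Sx mulr0.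
  move: gz; rewrite /grad; have := u0 z.1; have := u0 z.2; rewrite !indicE.
  case: (_ \in _); case: (_ \in _) => //= u2 u1; rewrite ?lerDl ?lerDr//.
  by rewrite u1// u2// subrr eqxx.
rewrite -mulrDr normrM (ger0_norm (K_ge0 z)) (le_trans (ler_piMr _ (K_le1 z)))//.
apply: (@le_trans _ _ (k * 1)); last by rewrite ler_wpM2l.
rewrite mulr1; apply: norm_dppow_bounded => //.
by rewrite (le_trans (ler_normB _ _))//; have := u_c z.1; have := u_c z.2; lra.
Qed.

Lemma bounded_support_pfinite : pfinite u.
Proof.
have g2 := L2B (L2_snd hm hrev bounded_support_L2) (L2_fst hm bounded_support_L2).
apply: rintegrable_le (L2_mul bounded_support_pflux_L2 g2) _.
  exact: measurable_p_density.
move=> z; rewrite ger0_norm ?p_density_ge0//; have := ppow_subgradient p1 0 (grad u z).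
rewrite ppow0// sub0r => sub0; rewrite [leRHS]mulrAC ler_wpM2r//.
by move: sub0; rewrite mulrN /grad; lra.
Qed.

Lemma subdiff_p_energy_bounded_support : subdiff nu E u (fun x => - plap u x).
Proof.
have fL := bounded_support_pflux_L2.
apply: subdiff_p_energy_plap => //.
- exact: bounded_support_L2.
- exact: bounded_support_pfinite.
- exists (pflux u), (cst 0); split=> //; last by apply/funext => z; rewrite addr0.
  exact: integrable0.
- exact: L2_fiber_integral.
Qed.

End bounded_support.

Section finite_or_superquadratic.
Hypothesis fin_or_p2 : (nu setT < +oo)%E \/ 2 <= p.

Lemma pfinite_bounded h (c : R) : L2 nu h -> (forall x, `|h x| <= c) -> pfinite h.
Proof.
move=> h2 hc; have mh := L2_measurable h2; have md := measurable_p_density mh.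
have gc z : `|grad h z| <= 2 * c.
  by rewrite (le_trans (ler_normB _ _))//; have := hc z.1; have := hc z.2; lra.
have le_ppow z : `|ppow p (grad h z) * K z| <= ppow p (grad h z).
  by rewrite ger0_norm ?p_density_ge0// ler_piMr.
case: fin_or_p2 => [nuy|p2].
  apply: rintegrable_le md (rintegrable_fst hm (rintegrable_cst (ppow p (2 * c)) nuy)) _.
  move=> z; apply: le_trans (le_ppow z) _; apply: ppow_le_norm => //.
  exact: le_trans (gc z) (ler_norm _).
have /L2P[_ g2] := L2B (L2_snd hm hrev h2) (L2_fst hm h2).
apply: rintegrable_le md (rintegrableZl ((2 * c) `^ (p - 2) / p) g2) _ => z.
by apply: le_trans (le_ppow z) _; exact: ppow_bounded.
Qed.

(* Split at [|grad u| = 1]. *)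
Lemma pflux_L2_plus_L1 u : L2 nu u -> pfinite u -> L2_plus_L1 M (pflux u).
Proof.
move=> u2 ui; have mu := L2_measurable u2; have mfl := measurable_pflux mu.
pose S := [set z | `|grad u z| <= 1].
have mS : measurable S.
  rewrite (_ : S = setT `&` (fun z => `|grad u z|) @^-1` `]-oo, 1]%classic).
    have mng : measurable_fun setT (fun z => `|grad u z|).
      by apply: measurableT_comp => //; exact: measurable_grad.
    by apply: mng => //; exact: measurable_itv.
  by rewrite setTI; apply/seteqP; split=> z /=; rewrite in_itv.
have mfS (C : set (X * X)) : measurable C -> measurable_fun setT (fun z => pflux u z * \1_C z).
  by move=> mC; apply: measurable_funM => //; exact: measurable_indic.
have norm_pflux z : `|pflux u z| <= `|dppow p (grad u z)|.
  by rewrite normrM (ger0_norm (K_ge0 z)) ler_piMr.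
exists (fun z => pflux u z * \1_S z), (fun z => pflux u z * \1_(~` S) z); split.
- case: fin_or_p2 => [nuy|p2].
    apply: L2_le (mfS _ mS) (L2_fst hm (L2_cst 1 nuy)) _ => z.
    rewrite normr1 indicE; have [|_] := boolP (z \in S); last by rewrite mulr0 normr0.
    by rewrite inE mulr1 => Sz; rewrite (le_trans (norm_pflux z))// norm_dppow_le1.
  apply: L2_le (mfS _ mS) (L2B (L2_snd hm hrev u2) (L2_fst hm u2)) _ => z.
  rewrite indicE; have [|_] := boolP (z \in S); last by rewrite mulr0 normr0.
  by rewrite inE mulr1 => Sz; rewrite (le_trans (norm_pflux z))// norm_dppow_le.
- apply: rintegrable_le (mfS _ (measurableC mS)) (rintegrableZl p ui) _ => z.
  rewrite indicE; have [|_] := boolP (z \in ~` S); last first.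
    rewrite mulr0 normr0; exact: mulr_ge0 (le_trans ler01 p1) (p_density_ge0 _ _).
  rewrite inE mulr1 => /negP; rewrite -ltNge => Sz.
  rewrite normrM (ger0_norm (K_ge0 z)) mulrA ler_wpM2r//.
  exact: norm_dppow_le_ppow.
- apply/funext => z; rewrite -mulrDr !indicE in_setC.
  by case: (_ \in _); rewrite ?addr0 ?add0r mulr1.
Qed.

End finite_or_superquadratic.

End p_laplacian.

(** * Lipschitz perturbations of the p-energy *)

Section perturbation.
Context {d : measure_display} {X : measurableType d} {R : realType}.
Variables (nu : {measure set X -> \bar R}) (m : X -> probability X R).
Hypotheses (hm : kernel_measurable m) (hrev : nu_reversible nu m).
Hypothesis nu_sfin : sigma_finite setT nu.
Variables (K : X * X -> R) (p : R).
Hypotheses (K_cond : conductance K) (p1 : 1 < p).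
Hypothesis fin_or_p2 : (nu setT < +oo)%E \/ 2 <= p.
Implicit Types (u v w h : X -> R).

Local Notation M := (graph_measure nu hm).
Local Notation E := (edge_energy nu m (ppow p) K).
Local Notation pfinite := (pfinite nu hm K p).
Local Notation flux := (pflux K p).
Local Notation lap := (plap m K p).

Let p1w : 1 <= p. Proof. exact: ltW. Qed.

Lemma cvg_Rintegral_pflux_grad u h (t_ : R^nat) : measurable_fun setT u ->
  measurable_fun setT h -> pfinite u -> pfinite h ->
  (forall n, `|t_ n| <= 1) -> t_ n @[n --> \oo] --> (0 : R) ->
  \int[M]_z (flux (fun x => u x + t_ n * h x) z * grad h z) @[n --> \oo] -->
  \int[M]_z (flux u z * grad h z).
Proof.
move=> mu mh ui hi t1 cvg_t; pose w n x := u x + t_ n * h x.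
have grad_w n z : grad (w n) z = grad u z + t_ n * grad h z by rewrite /grad /w; ring.
have mw n : measurable_fun setT (w n).
  by apply: measurable_funD => //; exact: measurable_funM.
have dom := rintegrableD (rintegrableZl ((p - 1) * 2 `^ p) (rintegrableD ui hi)) hi.
apply: (cvg_dominated_Rintegral _ _ dom) => [n|z|n z].
- apply: measurable_funM; last exact: measurable_grad.
  exact: (measurable_pflux p K_cond (mw n)).
- apply: cvgM; last exact: cvg_cst.
  apply: cvgM; last exact: cvg_cst.
  have cvg_grad : grad (w n) z @[n --> \oo] --> grad u z.
    rewrite -[X in _ --> X]addr0 -(mul0r (grad h z)); under eq_fun do rewrite grad_w.
    by apply: cvgD; [exact: cvg_cst|apply: cvgM => //; exact: cvg_cst].
  apply: (@cvg_comp _ _ _ (fun n => grad (w n) z) (dppow p) _ _ _ cvg_grad).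
  exact: continuous_dppow.
- apply: le_trans (norm_pflux_grad_le K_cond p1w (w n) h z) _; rewrite lerD2r -mulrA.
  rewrite ler_wpM2l ?subr_ge0// -mulrDl mulrA ler_wpM2r ?(conductance_ge0 K_cond)//.
  rewrite grad_w; apply: le_trans (ppowD_le p1w _ _) _.
  rewrite ler_wpM2l ?powR_ge0// lerD2l; apply: ppow_le_norm => //.
  by rewrite normrM ler_piMl.
Qed.

Lemma p_energy_le_tangent u h (t : R) : measurable_fun setT u ->
  measurable_fun setT h -> pfinite u -> pfinite h -> `|t| <= 1 ->
  (E (fun x => (u x + t * h x)%R) <= E u +
    (t * (2^-1 * \int[M]_z (flux (fun x => u x + t * h x) z * grad h z)))%:E)%E.
Proof.
move=> mu mh ui hi t1; set w := fun x => u x + t * h x.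
have mw : measurable_fun setT w by apply: measurable_funD => //; exact: measurable_funM.
have wi : pfinite w by exact: pfiniteD.
have := p_energy_subgradient K_cond p1w mw mu wi ui; rewrite -leeBrDr//.
have -> : \int[M]_z (flux w z * grad (fun x => u x - w x) z) =
    - t * \int[M]_z (flux w z * grad h z).
  rewrite -RintegralZl//; last exact: rintegrable_pflux_grad.
  by apply: eq_Rintegral => z _; rewrite /grad /w; ring.
by rewrite -EFinN; congr (_ <= _ + _%:E)%E; rewrite mulNr mulrN opprK mulrCA.
Qed.

Variable G : (X -> R) -> \bar R.
Hypothesis G_lip : lipschitz_functional nu G.
Local Notation F := (fun u => G u + E u)%E.

Let G_ge0 u : (0 <= G u)%E. Proof. exact: lipschitz_functional_ge0 G_lip u. Qed.
Let E_ge0 u : (0 <= E u)%E. Proof. exact: p_energy_ge0. Qed.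

Lemma subdiff_pfinite u v : subdiff nu F u v ->
  [/\ L2 nu u, L2 nu v, G u \is a fin_num & pfinite u].
Proof.
move=> [u2 [v2 [Fu _]]]; split=> //.
  by rewrite ge0_fin_numE// (le_lt_trans _ Fu)// leeDl.
apply/(p_energy_ltyP nu hm K_cond p1w (L2_measurable u2)).
by rewrite (le_lt_trans _ Fu)// leeDr.
Qed.

Lemma subdiff_directional u v h : subdiff nu F u v -> L2 nu h -> pfinite h ->
  (G u + (\int[nu]_x (v x * h x))%:E <=
   G (fun x => (u x + h x)%R) + (2^-1 * \int[M]_z (flux u z * grad h z))%:E)%E.
Proof.
move=> Fuv h2 hi; have [u2 _ _ ui] := subdiff_pfinite Fuv.
have mu := L2_measurable u2; have mh := L2_measurable h2.
have harmonic_le1 n : `|n.+1%:R^-1 : R| <= 1.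
  by rewrite ger0_norm// invf_le1 ?ler1n.
have G_convex := lipschitz_functional_convex G_lip.
apply: (subdiff_add_directional G_ge0 E_ge0 G_convex Fuv h2) => [n|].
  exact: p_energy_le_tangent.
apply: cvgM; first exact: cvg_cst.
by apply: cvg_Rintegral_pflux_grad => //; exact: cvg_harmonic.
Qed.

Lemma subdiff_L2_plus_L1_plap u v : subdiff nu F u v -> L2_plus_L1 nu (lap u).
Proof.
move=> /subdiff_pfinite[u2 _ _ ui]; apply: L2_plus_L1_fiber_integral.
exact: pflux_L2_plus_L1.
Qed.

Lemma subdiff_plap_pairing_le u v h (c : R) : subdiff nu F u v ->
  L2 nu h -> rintegrable nu h -> (forall x, `|h x| <= c) ->
  rintegrable nu (fun x => (v x + lap u x) * h x) /\
  \int[nu]_x ((v x + lap u x) * h x) <= \int[nu]_x `|h x|.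
Proof.
move=> Fuv h2 hi hc; have [u2 v2 Gu ui] := subdiff_pfinite Fuv.
have mu := L2_measurable u2; have vh := L2_mul v2 h2.
have lap_h := L2_plus_L1_mul (subdiff_L2_plus_L1_plap Fuv) h2 hc.
under eq_fun do rewrite mulrDl; split; first exact: rintegrableD.
have hf : pfinite h by exact: pfinite_bounded h2 hc.
have := le_trans (subdiff_directional Fuv h2 hf)
  (leeD (lipschitz_functionalD G_lip u2 hi) (lexx _)).
rewrite (green_formula_integrable hrev (pflux_antisym p K_cond u)); first last.
- apply: (L2_plus_L1_mul _ (L2_fst hm h2) (c := c)) => //.
  exact: pflux_L2_plus_L1.
- exact: measurable_pflux.
rewrite -(fineK Gu) -!EFinD lee_fin.
by rewrite RintegralD//; lra.
Qed.

(* Test the subgradient inequality with [h = +- \1_S]. *)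
Lemma subdiff_plap_norm_le1 u v : subdiff nu F u v ->
  {ae nu, forall x, `|v x + lap u x| <= 1}.
Proof.
move=> Fuv; have [u2 v2 _ _] := subdiff_pfinite Fuv.
have mz : measurable_fun setT (fun x => v x + lap u x).
  apply: measurable_funD; first exact: L2_measurable v2.
  by apply: measurable_plap => //; exact: L2_measurable u2.
have one_sided (s : R) : `|s| = 1 -> {ae nu, forall x, s * (v x + lap u x) <= 1}.
  move=> s1; apply: (ae_le_cst_indic nu_sfin); first exact: measurable_funM.
  move=> S mS Sy; have S2 := L2_indic mS Sy; have Si := rintegrable_indic mS Sy.
  have sS1 x : `|s * \1_S x| <= 1.
    by rewrite normrM s1 mul1r indicE; case: (_ \in _); rewrite ?normr1 ?normr0.
  have := subdiff_plap_pairing_le Fuv (L2Z s S2) (rintegrableZl s Si) sS1.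
  have -> : (fun x => (v x + lap u x) * (s * \1_S x)) =
      (fun x => s * (v x + lap u x) * \1_S x) by apply/funext => x; ring.
  rewrite mul1r; have -> // : \int[nu]_x `|s * \1_S x| = \int[nu]_x \1_S x.
  by apply: eq_Rintegral => x _; rewrite normrM s1 mul1r ger0_norm.
apply: filterS2 (one_sided 1 (normr1 _)) (one_sided (-1) (normrN1 _)) => x.
by rewrite mul1r mulN1r ler_norml => -> ?; rewrite andbT lerNl.
Qed.

Lemma subdiff_L2_plap u v : subdiff nu F u v -> L2 nu (lap u).
Proof.
move=> Fuv; have [_ v2 _ _] := subdiff_pfinite Fuv.
apply: (L2_plus_L1_L2 (subdiff_L2_plus_L1_plap Fuv) v2).
apply: filterS (subdiff_plap_norm_le1 Fuv) => x le1.
have := ler_normB (v x + lap u x) (v x).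
rewrite addrAC subrr add0r => /le_trans; apply.
by rewrite addrC lerD2l.
Qed.

(* Truncating the competitors of [G] makes them admissible for the p-energy. *)
Lemma subdiff_add_plap u v : subdiff nu F u v ->
  subdiff nu G u (fun x => v x + lap u x).
Proof.
move=> Fuv; have [u2 v2 Gu ui] := subdiff_pfinite Fuv.
have lap2 := subdiff_L2_plap Fuv; have z2 := L2D v2 lap2.
have mu := L2_measurable u2.
split=> //; split=> //; split=> [|w w2]; first by rewrite -ge0_fin_numE.
have [Gw|] := boolP (G w < +oo)%E; last by rewrite -leNgt leye_eq => /eqP ->; exact: leey.
have {}Gw : G w \is a fin_num by rewrite ge0_fin_numE.
pose T n x := clamp n%:R (w x).
have T2 n : L2 nu (T n) by exact: L2_clamp.
have h2 n := L2B (T2 n) u2.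
have hi n : pfinite (fun x => T n x - u x).
  apply: pfiniteB => //; first exact: L2_measurable (T2 n).
  by apply: (pfinite_bounded _ _ _ _ _ (T2 n) (c := n%:R)) => // x; exact: norm_clamp_le.
have truncated n : \int[nu]_x ((v x + lap u x) * (T n x - u x)) <= fine (G w) - fine (G u).
  have := subdiff_directional Fuv (h2 n) (hi n).
  rewrite (green_formula_plap hrev K_cond p1w mu ui _ lap2 (h2 n) (hi n)); last first.
    exact: pflux_L2_plus_L1.
  have -> : (fun x => u x + (T n x - u x)) = T n by apply/funext => x; rewrite addrC subrK.
  move=> /le_trans/(_ (leeD (lipschitz_functional_clamp G_lip (ler0n R n) w2) (lexx _))).
  rewrite -(fineK Gu) -(fineK Gw) -!EFinD lee_fin => le_Gw.
  under eq_Rintegral do rewrite mulrDl.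
  rewrite RintegralD; [|by []|exact: (L2_mul v2 (h2 n))|exact: (L2_mul lap2 (h2 n))].
  by lra.
have lim_T : \int[nu]_x ((v x + lap u x) * (T n x - u x)) @[n --> \oo] -->
    \int[nu]_x ((v x + lap u x) * (w x - u x)).
  have dom := rintegrableD (rintegrable_norm (L2_mul z2 w2)) (rintegrable_norm (L2_mul z2 u2)).
  apply: (cvg_dominated_Rintegral _ _ dom) => [n|x|n x].
  - by apply: measurable_funM; [exact: L2_measurable z2|exact: L2_measurable (h2 n)].
  - apply: cvgM; first exact: cvg_cst.
    by apply: cvgB; [exact: cvg_clamp|exact: cvg_cst].
  - rewrite !normrM -mulrDr ler_wpM2l// (le_trans (ler_normB _ _))// lerD2r.
    apply: firmly_nonexpansive_norm; last exact: clamp0.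
    exact: clamp_firmly_nonexpansive.
rewrite (rintegralE (L2_mul z2 (L2B w2 u2))) -(fineK Gu) -(fineK Gw) -EFinD lee_fin.
by rewrite -lerBrDl; apply: (cvgr_to_le lim_T); exact: nearW.
Qed.

Theorem subdiff_add_lipschitz :
  subdiff nu F = opadd (subdiff nu G) (subdiff nu E).
Proof.
apply/funext => u; apply/funext => v; apply/propext; split; last first.
  by move=> [v1 [v2 [Gv1 [Ev2 ->]]]]; exact: subdiff_add.
move=> Fuv; have [u2 _ _ ui] := subdiff_pfinite Fuv.
exists (fun x => v x + lap u x), (fun x => - lap u x); split.
  exact: subdiff_add_plap.
split; last by apply/funext => x; rewrite /= addrK.
apply: subdiff_p_energy_plap => //; last exact: subdiff_L2_plap Fuv.
exact: pflux_L2_plus_L1.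
Qed.

End perturbation.

(** * Identification of the operators *)

Section identification.
Context {d : measure_display} {X : measurableType d} {R : realType}.
Variables (nu : {measure set X -> \bar R}) (m : X -> probability X R).
Hypotheses (hm : kernel_measurable m) (hrev : nu_reversible nu m).
Implicit Types (u v : X -> R) (K : X * X -> R).

Local Notation M := (graph_measure nu hm).
Local Notation E p K := (edge_energy nu m (ppow p) K).

Lemma p_energy_exchange p K : 1 <= p -> conductance K ->
  exchange_contracting nu (E p K).
Proof.
move=> p1 K_cond; apply: (edge_energy_exchange hm (measurable_ppow p)) => //.
- by move=> t; exact: ppow_ge0.
- exact: subgradient_convex (ppow_subgradient p1).
Qed.

Lemma lipschitz_total_variation K : conductance K -> lipschitz_functional nu (E 1 K).
Proof.
move=> K_cond; apply: (lipschitz_functional_edge_energy hm hrev (measurable_ppow 1)) => //.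
- by move=> t; exact: ppow_ge0.
- by move=> s t; rewrite /ppow !powRr1// !divr1 ler_normD.
- exact: subgradient_convex (ppow_subgradient (lexx 1)).
- by move=> s t; exact: ppow_le_norm.
Qed.

Lemma dense_domain_subdiff_add p q K L : 1 <= p -> 1 <= q ->
  conductance K -> conductance L ->
  dense_domain nu (subdiff nu (fun u => E p K u + E q L u)%E).
Proof.
move=> p1 q1 K_cond L_cond f f2 e e0.
have [S [c [u [[mS S_fin] mu u_le uf]]]] := L2_bounded_support_dense f2 e0.
have subK := subdiff_p_energy_bounded_support hm hrev K_cond p1 mS S_fin mu u_le.
have subL := subdiff_p_energy_bounded_support hm hrev L_cond q1 mS S_fin mu u_le.
by exists u; eexists; split; [exact: subdiff_add subK subL|].
Qed.

Lemma FA1E (A : X -> set X) : FA1 nu m A = E 1 (Kset A).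
Proof.
apply/funext => u; congr (_ * nuxm _ _ _)%E; apply/funext => z.
by rewrite /ppow powRr1// divr1.
Qed.

Lemma subdiff_FA1_Lap1 (A : X -> set X) :
  subdiff nu (FA1 nu m A) = opneg (Lap1 nu m A).
Proof.
apply/funext => u; apply/funext => v; congr (subdiff _ _ _ _).
by apply/funext => x /=; rewrite opprK.
Qed.

Lemma nuxm_powR_p_energy (K : X * X -> R) p u : 1 <= p -> conductance K ->
  measurable_fun setT u ->
  nuxm nu m (fun z => (`|grad u z| `^ p * K z)%:E) = ((2 * p)%:E * E p K u)%E.
Proof.
move=> p1 K_cond mu; have md := measurable_density (measurable_ppow p) K_cond mu.
rewrite (edge_energyE nu hm (measurable_ppow p) (ppow_ge0 p1) K_cond mu) muleA.
rewrite -EFinM (_ : 2 * p * 2^-1 = p); last by field.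
have d0 z : 0 <= ppow p (grad u z) * K z.
  by rewrite mulr_ge0 ?ppow_ge0 ?(conductance_ge0 K_cond).
rewrite -ge0_integralZl_EFin//; last 3 first.
- by move=> z _; rewrite lee_fin.
- exact/measurable_EFinP.
- by rewrite (le_trans _ p1).
rewrite -ge0_integral_graph_measure; last 2 first.
- by move=> z; rewrite lee_fin mulr_ge0 ?powR_ge0 ?(conductance_ge0 K_cond).
- apply/measurable_EFinP.
  exact: (measurable_density (measurable_norm_powR p) K_cond mu).
by apply: eq_integral => z _; rewrite -EFinM mulrA ppowM.
Qed.

Lemma subdiff_cst0_ae_eq0 u v : subdiff nu (fun=> 0%E) u v -> {ae nu, forall x, v x = 0}.
Proof.
move=> [u2 [v2 [_ sub]]]; have /L2P[_ vi] := v2; have := sub _ (L2D u2 v2).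
have -> : (fun x => (v x * (u x + v x - u x))%:E) = (fun x => (v x ^+ 2)%:E).
  by apply/funext => x; congr EFin; ring.
rewrite add0e rintegralE// lee_fin => /(Rintegral_le0_ae_eq0 vi (fun x => sqr_ge0 _)).
by apply: filterS => x /eqP; rewrite sqrf_eq0 => /eqP.
Qed.

Section p_laplacian_operator.
Hypothesis nu_sfin : sigma_finite setT nu.
Variable p : R.
Hypotheses (p1 : 1 < p) (fin_or_p2 : (nu setT < +oo)%E \/ 2 <= p).

Lemma subdiff_p_energyP K u v : conductance K -> subdiff nu (E p K) u v <->
  [/\ L2 nu u, L2 nu v, pfinite nu hm K p u & {ae nu, forall x, v x = - plap m K p u x}].
Proof.
move=> K_cond; split=> [Euv|[u2 v2 ui v_lap]].
  have Fuv : subdiff nu (fun w => 0 + E p K w)%E u v by under eq_fun do rewrite add0e.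
  have G_lip := lipschitz_functional0 nu.
  have [u2 v2 _ ui] := subdiff_pfinite hm K_cond p1 G_lip Fuv.
  have /subdiff_cst0_ae_eq0 v_lap :=
    subdiff_add_plap hm hrev nu_sfin K_cond p1 fin_or_p2 G_lip Fuv.
  by split=> //; apply: filterS v_lap => x /eqP; rewrite addr_eq0 => /eqP.
have lap2 : L2 nu (plap m K p u).
  apply: eq_ae_L2 (L2N v2).
    by apply: (measurable_plap hm); [exact: K_cond|exact: L2_measurable u2].
  by apply: filterS v_lap => x ->; rewrite opprK.
apply: (eq_ae_subdiff v2); last first.
  apply: (subdiff_p_energy_plap hrev K_cond (ltW p1) u2 ui _ lap2).
  exact: (pflux_L2_plus_L1 hrev K_cond (ltW p1) fin_or_p2 u2 ui).
by apply: filterS v_lap => x ->.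
Qed.

Variable B : X -> set X.
Hypothesis mB : measurable [set z : X * X | B z.1 z.2].

Let B_cond : conductance (Kset B : X * X -> R). Proof. exact: conductance_Kset. Qed.

Lemma FBpE u : measurable_fun setT u -> FBp nu m B p u = E p (Kset B) u.
Proof.
move=> mu; have dp0 : 2 * p != 0 by rewrite gt_eqF// mulr_gt0// (lt_trans _ p1).
by rewrite /FBp (nuxm_powR_p_energy (ltW p1) B_cond mu) muleA -EFinM mulVf// mul1e.
Qed.

Let Lapp_integrandE u z :
  Kset B z * `|grad u z| `^ (p - 2) * grad u z = pflux (Kset B) p u z.
Proof. by rewrite /pflux /dppow; ring. Qed.

Lemma LappP u v : Lapp nu m B p u v <->
  [/\ L2 nu u, L2 nu v, pfinite nu hm (Kset B) p u &
      {ae nu, forall x, v x = plap m (Kset B) p u x}].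
Proof.
have finE : L2 nu u ->
    (nuxm nu m (fun z => (Kset B z * `|grad u z| `^ p)%:E) < +oo)%E <->
    pfinite nu hm (Kset B) p u.
  move=> u2; have mu := L2_measurable u2; under eq_fun do rewrite mulrC.
  rewrite (nuxm_powR_p_energy (ltW p1) B_cond mu).
  rewrite -(p_energy_ltyP nu hm B_cond (ltW p1) mu).
  have dp0 : 0 < 2 * p by rewrite mulr_gt0// (lt_trans _ p1).
  split=> [|uy]; last by apply: lte_mul_pinfty => //; rewrite lee_fin ltW.
  by rewrite !ltey; apply: contra => /eqP ->; rewrite gt0_muley ?lte_fin.
split=> [[u2 [v2 [/(finE u2) ui v_lap]]]|[u2 v2 ui v_lap]].
  split=> //; apply: filterS v_lap => x /(congr1 fine) /= ->.
  by apply: eq_Rintegral => y _; exact: Lapp_integrandE.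
split=> //; split=> //; split; first exact/finE.
have fL := pflux_L2_plus_L1 hrev B_cond (ltW p1) fin_or_p2 u2 ui.
apply: filterS2 v_lap (ae_rintegrable_fiber_L2_plus_L1 fL) => x -> fx.
by under eq_integral do rewrite Lapp_integrandE; rewrite rintegralE.
Qed.

Lemma subdiff_FBp_Lapp : subdiff nu (FBp nu m B p) = opneg (Lapp nu m B p).
Proof.
rewrite (eq_subdiff (fun w (w2 : L2 nu w) => FBpE (L2_measurable w2))).
apply/funext => u; apply/funext => v; apply/propext.
rewrite subdiff_p_energyP// /opneg LappP.
split=> -[u2 v2 ui v_lap]; split=> //.
- exact: L2N.
- by apply: filterS v_lap => x /= ->; rewrite opprK.
- by have := L2N v2; under eq_fun do rewrite opprK.
- by apply: filterS v_lap => x /= <-; rewrite opprK.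
Qed.

End p_laplacian_operator.

End identification.

Theorem theorem4p3 (d : measure_display) (X : measurableType d) (R : realType)
  (m : X -> probability X R) (nu : {measure set X -> \bar R})
  (A B : X -> set X) (p : R) :
  countably_generated (X := X) ->
  kernel_measurable m ->
  sigma_finite setT nu ->
  nu_invariant nu m ->
  nu_reversible nu m ->
  1 < p ->
  measurable [set xy : X * X | A xy.1 xy.2] ->
  measurable [set xy : X * X | B xy.1 xy.2] ->
  (forall x, measurable (A x) /\ measurable (B x) /\
     (0 < m x (A x))%E /\ (0 < m x (B x))%E /\
     m x (~` (A x `|` B x)) = 0%E) ->
  ((nu setT < +oo)%E \/ (nu setT = +oo%E /\ 2 <= p)) ->
  let F := fun u => (FA1 nu m A u + FBp nu m B p u)%E in
  subdiff nu F = opadd (subdiff nu (FA1 nu m A)) (subdiff nu (FBp nu m B p)) /\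
  opadd (subdiff nu (FA1 nu m A)) (subdiff nu (FBp nu m B p))
    = opadd (opneg (Lap1 nu m A)) (opneg (Lapp nu m B p)) /\
  completely_accretive nu (subdiff nu F) /\
  dense_domain nu (subdiff nu F).
Proof.
move=> _ hm nu_sfin _ hrev p1 mA mB _ case_ab F.
have fin_or_p2 : (nu setT < +oo)%E \/ 2 <= p by case: case_ab => [|[]]; [left|right].
have A_cond : conductance (Kset A : X * X -> R) := conductance_Kset mA.
have B_cond : conductance (Kset B : X * X -> R) := conductance_Kset mB.
have FB_E u : L2 nu u -> FBp nu m B p u = edge_energy nu m (ppow p) (Kset B) u.
  by move=> /L2_measurable; exact: FBpE.
rewrite -subdiff_FA1_Lap1 -(subdiff_FBp_Lapp hm hrev nu_sfin p1 fin_or_p2 mB).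
have FE w : L2 nu w -> F w = (edge_energy nu m (ppow 1) (Kset A) w +
    edge_energy nu m (ppow p) (Kset B) w)%E by move=> w2; rewrite /F FA1E FB_E.
rewrite (eq_subdiff FE) (eq_subdiff FB_E) FA1E.
split; first exact: subdiff_add_lipschitz (lipschitz_total_variation hm hrev A_cond).
split=> //; split.
  apply: subdiff_completely_accretive => [u|].
    by apply: adde_ge0; apply: p_energy_ge0 => //; exact: ltW.
  by apply: exchange_contractingD; apply: (p_energy_exchange hm) => //; exact: ltW.
exact: (dense_domain_subdiff_add hm hrev (lexx 1) (ltW p1) A_cond B_cond).
Qed.
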